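(* There is a randomized algorithm for the 0-1 knapsack problem that runs in $\widetilde{O}(n^{3/2}w_{\max})$ time and outputs the optimal value $\mathrm{OPT}$ correctly with high probability.
   Context: In the 0-1 knapsack problem, the input is a capacity $W\in\mathbb{Z}^+$ and $n$ items $(w_1,p_1),\dots,(w_n,p_n)$ with weights $w_i\in\mathbb{Z}^+$ and profits $p_i\in\mathbb{Z}^+$. The goal is to compute $\mathrm{OPT}=\max\{\sum_{i\in S}p_i : S\subseteq\{1,\dots,n\},\ \sum_{i\in S}w_i\le W\}$. Here $w_{\max}=\max_i w_i$. The notation $\widetilde{O}(\cdot)$ hides polylogarithmic factors, and ''with high probability'' means with probability at least $1-1/\mathrm{poly}(n)$. *)

(* Defs.v *)
From Stdlib Require Import PeanoNat.
From mathcomp Require Import all_boot all_order.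
Set Implicit Arguments. Unset Strict Implicit. Unset Printing Implicit Defensive.

Definition OPT (n W : nat) (w p : 'I_n -> nat) : nat :=
  \max_(S : {set 'I_n} | \sum_(i in S) w i <= W) \sum_(i in S) p i.

Definition wmax (n : nat) (w : 'I_n -> nat) : nat := \max_(i < n) w i.

Inductive instr : Type :=
| IConst of nat & nat
| IAdd   of nat & nat & nat
| ISub   of nat & nat & nat      (* truncated subtraction                      *)
| IMul   of nat & nat & nat
| IDiv   of nat & nat & nat      (* floor division, x / 0 = 0                  *)
| IAnd   of nat & nat & nat
| IOr    of nat & nat & nat
| IXor   of nat & nat & nat
| ILoad  of nat & nat
| IStore of nat & nat
| IJlt   of nat & nat & nat
| IRand  of nat
| IHalt.

Record state : Type := State { pc : nat; mem : nat -> nat; used : nat }.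

Definition upd (m : nat -> nat) (a v : nat) : nat -> nat :=
  fun x => if x == a then v else m x.

(* [exec P r B fuel s] runs program P (a pc outside P means halt) with random
   bit string r, for at most [fuel] steps (each instruction, including the
   final halt, costs one step).  It returns [Some out] iff the machine halts
   within [fuel] steps, never writes a value larger than the word bound B
   (word-RAM restriction), and [out] is mem[0] at halting time. *)
Fixpoint exec (P : seq instr) (r : seq bool) (B : nat) (fuel : nat) (s : state)
  : option nat :=
  match fuel with
  | 0 => None
  | f.+1 =>
    let m := mem s in
    let nxt a v := if v <= B then exec P r B f (State (pc s).+1 (upd m a v) (used s))
                   else None in
    match nth IHalt P (pc s) with
    | IHalt => Some (m 0)
    | IConst a v => nxt a v
    | IAdd a b c => nxt a (m b + m c)
    | ISub a b c => nxt a (m b - m c)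
    | IMul a b c => nxt a (m b * m c)
    | IDiv a b c => nxt a (Nat.div (m b) (m c))
    | IAnd a b c => nxt a (Nat.land (m b) (m c))
    | IOr a b c => nxt a (Nat.lor (m b) (m c))
    | IXor a b c => nxt a (Nat.lxor (m b) (m c))
    | ILoad a b => nxt a (m (m b))
    | IStore a b => nxt (m a) (m b)
    | IJlt a b l =>
        exec P r B f (State (if m a < m b then l else (pc s).+1) m (used s))
    | IRand a =>
        exec P r B f (State (pc s).+1 (upd m a (nth false r (used s))) (used s).+1)
    end
  end.

(* Input encoding: mem[0] = n, mem[1] = W, mem[2+2i] = w_i, mem[3+2i] = p_i
   (items indexed from 0), all other cells 0. *)
Definition init_mem (n W : nat) (w p : 'I_n -> nat) : nat -> nat :=
  fun a =>
    if a == 0 then n else if a == 1 then W else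
    match @insub nat (fun j => j < n) 'I_n ((a - 2)./2) with
    | Some i => if odd a then p i else w i
    | None => 0
    end.

Definition init_state (n W : nat) (w p : 'I_n -> nat) : state :=
  State 0 (init_mem W w p) 0.

(* Word bound: cells may hold values polynomial in the input magnitude. *)
Definition word_bound (cw n W : nat) (w p : 'I_n -> nat) : nat :=
  (2 + n + W + \sum_(i < n) (w i + p i)) ^ cw.

(* Time bound  c * n^{3/2} * wmax * polylog(n + wmax)  (with n*(isqrt n + 1)
   standing for n^{3/2} up to a factor 2, and log = floor log2, +1). *)
Definition time_bound (c k n : nat) (wm : nat) : nat :=
  c * n * (Nat.sqrt n).+1 * wm * (trunc_log 2 (n + wm)).+1 ^ k.

(* Main.v *)
Require Import Defs.
From Stdlib Require Import PeanoNat.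
From mathcomp Require Import all_boot all_order all_algebra.
From mathcomp Require Import zify ring lra.

Set Implicit Arguments. Unset Strict Implicit. Unset Printing Implicit Defensive.

(* Every item independently gets a uniform key in [0, M), where M = 2^L is about
   sqrt n, and the items are processed bucket by bucket, by increasing key.  For
   a fixed optimal set S of weight close to W' = min(W, sum of all weights), the
   weight of the part of S with keys below t is within D = O(sqrt n * wmax * log n)
   of its mean (t / M) w(S), for all t simultaneously, with high probability.  So
   in bucket t the dynamic program over weights only has to update a window of
   O(D) cells around t W' / M.  Cell v always holds the profit of some set of
   processed items of weight at most v (a fresh cell, 0, stands for the empty
   set), hence the answer never exceeds the optimum, and it equals the optimum
   when all partial weights of S fall in their windows.  Finding each bucket by
   scanning all n items costs M n = O(n^(3/2)).

   For the deviations, let y_i be the centred contribution of item i divided by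
   M * wmax.  Then E prod (1 + y_i) = 1 exactly, by independence, whereas
   prod (1 + y_i) is large as soon as sum y_i is, because sum y_i^2 <= 1; Markov's
   inequality concludes. *)

(** * A loop language and its compiler *)

(** The number of buckets balances three quantities. Scanning costs [M * n]; the centre [t W' / M]
    advances by [W' / M <= n * wmax / M] per bucket, and this drift must fit in the window; and the
    normalised contributions satisfy [sum y_i^2 <= n / M^2]. The choice [n <= M^2 < 4 n] settles all
    three, and a power of two lets fair bits produce exactly uniform keys. The windows are centred
    with the known [W'], since [w(S)] is unknown: as profits are positive, an optimal set leaves a
    gap smaller than [wmax] below [W'], so the two centres differ by less than [wmax]. The product
    [prod (1 + y_i)] plays the part of an exponential moment, but stays rational and has an exact
    mean. The failure exponent [d] enters the program only through the constant [C = 4 d + 6] in the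
    window width. On the machine side a write above the word bound aborts the run, so every fact
    about a program carries a bound on the stored values besides its step count. *)

Inductive bop := Add | Sub | Mul | Div.

Definition bop_sem o : nat -> nat -> nat :=
  match o with Add => addn | Sub => subn | Mul => muln | Div => divn end.

Definition bop_instr o : nat -> nat -> nat -> instr :=
  match o with Add => IAdd | Sub => ISub | Mul => IMul | Div => IDiv end.

Inductive expr :=
| Var of nat
| Cst of nat
| Bin of bop & expr & expr
| Get of nat & expr.

Inductive cmd :=
| Asg of nat & expr
| Put of nat & expr & expr
| Rnd of nat
| Seq of cmd & cmd
| For of nat & nat & cmd.

Record store := Store { rg : nat -> nat; ar : nat -> nat -> nat; us : nat }.

Definition setr s x v := Store (upd (rg s) x v) (ar s) (us s).

Definition seta s a i v :=
  Store (rg s) (fun b j => if (b == a) && (j == i) then v else ar s b j) (us s).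

Fixpoint eval e s : nat :=
  match e with
  | Var x => rg s x
  | Cst v => v
  | Bin o e1 e2 => bop_sem o (eval e1 s) (eval e2 s)
  | Get a e1 => ar s a (eval e1 s)
  end.

Definition succr s x := setr s x (rg s x).+1.

Fixpoint run (r : seq bool) c s : store :=
  match c with
  | Asg x e => setr s x (eval e s)
  | Put a e1 e2 => seta s a (eval e1 s) (eval e2 s)
  | Rnd x => let s1 := setr s x (nth false r (us s)) in
             Store (rg s1) (ar s1) (us s).+1
  | Seq c1 c2 => run r c2 (run r c1 s)
  | For x y c1 => iter (rg s y) (fun s1 => succr (run r c1 s1) x) (setr s x 0)
  end.

Definition loop r x c s k := iter k (fun s1 => succr (run r c s1) x) (setr s x 0).

(* Array [a] is stored at the addresses congruent to [a] modulo [narr], counted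
   from a base address kept in cell [rbase]; the cells below [nvar] are the
   variables, and those in [tmp0, ncell) are scratch space. *)
Definition narr := 3.
Definition nvar := 21.
Definition rzero := 21.
Definition rone := 22.
Definition rbase := 23.
Definition tmp0 := 24.
Definition ncell := 36.

Definition addr_code a d :=
  [:: IConst d.+1 narr; IMul d d d.+1; IConst d.+1 a; IAdd d d d.+1; IAdd d d rbase].

(** The cells from [d] on serve as a stack: the left operand waits in [d] while the right one is
    computed from [d.+1]. Adding [rzero] is a move. *)
Fixpoint cexp e d : seq instr :=
  match e with
  | Var x => [:: IAdd d x rzero]
  | Cst v => [:: IConst d v]
  | Bin o e1 e2 => cexp e1 d ++ cexp e2 d.+1 ++ [:: bop_instr o d d d.+1]
  | Get a e1 => cexp e1 d ++ addr_code a d ++ [:: ILoad d d]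
  end.

Fixpoint csize c : nat :=
  match c with
  | Asg x e => (size (cexp e tmp0)).+1
  | Put a e1 e2 => size (cexp e2 tmp0) + (size (cexp e1 tmp0.+1) + 6)
  | Rnd x => 1
  | Seq c1 c2 => csize c1 + csize c2
  | For x y c1 => csize c1 + 5
  end.

(** [IJlt rzero rone] is an unconditional jump, because [rzero] holds 0 and [rone] holds 1. The loop
    test sits at [off + 1], the exit jump at [off + 2] and the body at [off + 3]. *)
Fixpoint comp c off : seq instr :=
  match c with
  | Asg x e => cexp e tmp0 ++ [:: IAdd x tmp0 rzero]
  | Put a e1 e2 => cexp e2 tmp0 ++ cexp e1 tmp0.+1 ++ addr_code a tmp0.+1
                     ++ [:: IStore tmp0.+1 tmp0]
  | Rnd x => [:: IRand x]
  | Seq c1 c2 => comp c1 off ++ comp c2 (off + csize c1)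
  | For x y c1 =>
      [:: IConst x 0; IJlt x y (off + 3); IJlt rzero rone (off + (csize c1 + 5))]
        ++ comp c1 (off + 3) ++ [:: IAdd x x rone; IJlt rzero rone (off + 1)]
  end.

Fixpoint cost r c s : nat :=
  match c with
  | Asg _ _ | Put _ _ _ | Rnd _ => csize c
  | Seq c1 c2 => cost r c1 s + cost r c2 (run r c1 s)
  | For x y c1 => 3 + \sum_(k < rg s y) (3 + cost r c1 (loop r x c1 s k))
  end.

(** An exponent for magnitudes: a leaf is at most [U ^ K], and each operation at most multiplies the
    bounds of its operands. The extra 1 for [Get] makes room for the address computation. *)
Fixpoint esize e : nat :=
  match e with
  | Var _ | Cst _ => 1
  | Bin _ e1 e2 => esize e1 + esize e2
  | Get a e1 => (esize e1).+1
  end.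

Fixpoint edepth e : nat :=
  match e with
  | Var _ | Cst _ => 1
  | Bin _ e1 e2 => maxn (edepth e1) (edepth e2).+1
  | Get a e1 => maxn (edepth e1) 2
  end.

Fixpoint ewf K e : bool :=
  match e with
  | Var x => x < nvar
  | Cst v => v <= K
  | Bin _ e1 e2 => ewf K e1 && ewf K e2
  | Get a e1 => (a < narr) && ewf K e1
  end.

Fixpoint writes c : seq nat :=
  match c with
  | Asg x _ | Rnd x => [:: x]
  | Put _ _ _ => [::]
  | Seq c1 c2 => writes c1 ++ writes c2
  | For x _ c1 => x :: writes c1
  end.

(** The conditions on [For] reconcile two semantics: [run] reads the bound [y] once, whereas the
    compiled loop rereads [x] and [y] at every test. *)
Fixpoint cwf K Z c : bool :=
  match c with
  | Asg x e => [&& x < nvar, ewf K e, esize e <= Z & tmp0 + edepth e <= ncell]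
  | Put a e1 e2 =>
      [&& a < narr, ewf K e1, ewf K e2, esize e1 < Z, esize e2 <= Z,
          tmp0 + edepth e2 <= ncell & tmp0 + (maxn (edepth e1) 2).+1 <= ncell]
  | Rnd x => x < nvar
  | Seq c1 c2 => cwf K Z c1 && cwf K Z c2
  | For x y c1 => [&& x < nvar, y < nvar, x != y, x \notin writes c1,
                      y \notin writes c1 & cwf K Z c1]
  end.

(** Only stored values are constrained; intermediate values inside an expression are controlled by
    [eval_le]. *)
Fixpoint ok (V : nat) r c s : Prop :=
  match c with
  | Asg x e => eval e s <= V
  | Put a e1 e2 => eval e2 s <= V
  | Rnd x => True
  | Seq c1 c2 => ok V r c1 s /\ ok V r c2 (run r c1 s)
  | For x y c1 => forall k, k < rg s y -> ok V r c1 (loop r x c1 s k)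
  end.

Lemma rg_run r c s z : z \notin writes c -> rg (run r c s) z = rg s z.
Proof.
elim: c s => [x e|a e1 e2|x|c1 IH1 c2 IH2|x y c1 IH] s //=.
- by rewrite inE /upd => /negbTE ->.
- by rewrite inE /upd => /negbTE ->.
- by rewrite mem_cat negb_or => /andP[h1 h2]; rewrite IH2 // IH1.
- rewrite inE negb_or => /andP[/negbTE hx hc].
  by elim: (rg s y) => [|k IHk] /=; rewrite /upd hx ?IH.
Qed.

Lemma loop_counter r x c s k : x \notin writes c -> rg (loop r x c s k) x = k.
Proof.
move=> hx; elim: k => [|k IHk] /=; first by rewrite /upd eqxx.
by rewrite /upd eqxx rg_run // IHk.
Qed.

Lemma loop_frame r x c s k z :
  z != x -> z \notin writes c -> rg (loop r x c s k) z = rg s z.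
Proof.
move=> /negbTE hz hc; elim: k => [|k IHk] /=; first by rewrite /upd hz.
by rewrite /upd hz rg_run.
Qed.

Lemma nat_divE a b : Nat.div a b = a %/ b.
Proof.
case: b => [|b]; first by rewrite divn0.
symmetry; apply: (Nat.div_unique _ _ _ (a %% b.+1)).
- by have := ltn_pmod a (ltn0Sn b); lia.
- by have := divn_eq a b.+1; lia.
Qed.

(** * Correctness of the compiler, with exact step counts *)

Section Compiler.
Variables (P : seq instr) (r : seq bool) (U K Z cw X : nat).
Hypothesis U2 : 1 < U.
Hypothesis K7 : 6 < K.
Hypothesis hcw : K * Z <= cw.
Hypothesis hX : X <= U ^ 4.
Hypothesis hXc : ncell <= X.
Hypothesis Z0 : 0 < Z.
Local Notation B := (U ^ cw).
Local Notation V := (U ^ K).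

(** Quantifying over the remaining fuel makes runs compose by rewriting, without any assumption that
    the machine halts. *)
Definition steps k s s' := forall f, exec P r B (k + f) s = exec P r B f s'.

Lemma steps0 s : steps 0 s s.
Proof. by []. Qed.

Lemma steps_trans k1 k2 s1 s2 s3 :
  steps k1 s1 s2 -> steps k2 s2 s3 -> steps (k1 + k2) s1 s3.
Proof. by move=> h1 h2 f; rewrite -addnA h1 h2. Qed.

Definition code_at off c := forall i, i < size c -> nth IHalt P (off + i) = nth IHalt c i.

Lemma code_at_cat off c1 c2 :
  code_at off (c1 ++ c2) -> code_at off c1 /\ code_at (off + size c1) c2.
Proof.
move=> h; split=> i hi.
- by rewrite h ?size_cat; [rewrite nth_cat hi | lia].
- rewrite -addnA h ?size_cat; last by rewrite ltn_add2l.
  by rewrite nth_cat ltnNge leq_addr /= addKn.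
Qed.

Lemma code_at_cons off i c :
  code_at off (i :: c) -> nth IHalt P off = i /\ code_at off.+1 c.
Proof.
move=> h; split; first by have := h 0 isT; rewrite addn0.
by move=> j hj; have := h j.+1 hj; rewrite addnS.
Qed.

Definition writes_to i a (v : (nat -> nat) -> nat) :=
  forall pc0 m u, nth IHalt P pc0 = i -> v m <= B ->
    steps 1 (State pc0 m u) (State pc0.+1 (upd m a (v m)) u).

Lemma step_const a v : writes_to (IConst a v) a (fun=> v).
Proof. by move=> q m u hq hv f; rewrite add1n /= hq hv. Qed.

Lemma step_bop o a b c : writes_to (bop_instr o a b c) a (fun m => bop_sem o (m b) (m c)).
Proof. by case: o => q m u hq hv f; rewrite add1n /= hq /= ?nat_divE hv. Qed.

Lemma step_load a b : writes_to (ILoad a b) a (fun m => m (m b)).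
Proof. by move=> q m u hq hv f; rewrite add1n /= hq hv. Qed.

Lemma step_store pc0 m u a b : nth IHalt P pc0 = IStore a b -> m b <= B ->
  steps 1 (State pc0 m u) (State pc0.+1 (upd m (m a) (m b)) u).
Proof. by move=> hq hv f; rewrite add1n /= hq hv. Qed.

Lemma step_jlt pc0 m u a b l : nth IHalt P pc0 = IJlt a b l ->
  steps 1 (State pc0 m u) (State (if m a < m b then l else pc0.+1) m u).
Proof. by move=> hq f; rewrite add1n /= hq. Qed.

Lemma step_rand pc0 m u a : nth IHalt P pc0 = IRand a ->
  steps 1 (State pc0 m u) (State pc0.+1 (upd m a (nth false r u)) u.+1).
Proof. by move=> hq f; rewrite add1n /= hq. Qed.

Definition sim (s : store) (m : nat -> nat) :=
  [/\ forall x, x < nvar -> m x = rg s x,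
      m rzero = 0, m rone = 1, m rbase = X &
      forall a i, a < narr -> m (X + (i * narr + a)) = ar s a i].

Definition bounded (s : store) :=
  (forall x, x < nvar -> rg s x <= V) /\ (forall a i, a < narr -> ar s a i <= V).

Lemma sim_frame s m m' : sim s m ->
  (forall x, (x < tmp0) || (ncell <= x) -> m' x = m x) -> sim s m'.
Proof.
case=> h1 h2 h3 h4 h5 hf; split; rewrite ?hf //.
- by move=> x hx; rewrite hf ?h1 //; apply/orP; left; apply: ltn_trans hx _.
- move=> a i ha; rewrite hf ?h5 //; apply/orP; right; lia.
Qed.

Lemma pow_le a b : a <= b -> U ^ a <= U ^ b.
Proof. by move=> h; rewrite leq_exp2l. Qed.

Lemma const_le v k : v <= k -> v <= U ^ k.
Proof. by move=> h; apply: leq_trans (pow_le h); apply: ltnW; apply: ltn_expl. Qed.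

Lemma eval_le e s : bounded s -> ewf K e -> eval e s <= U ^ (K * esize e).
Proof.
case=> h1 h2; elim: e => [x|v|o e1 IH1 e2 IH2|a e IH] /=.
- by rewrite muln1; apply: h1.
- by rewrite muln1; apply: const_le.
- move=> /andP[/IH1 b1 /IH2 b2]; rewrite mulnDr expnD.
  (* Both bounds [u] and [v] are at least 2, hence [u + v <= u * v], and a single product bound
     serves all four operations. *)
  have s0 : forall e, 0 < esize e.
    by elim=> //= o' e' he' e'' he''; rewrite addn_gt0 he'.
  have p2 : forall e, 1 < U ^ (K * esize e).
    move=> e; apply: leq_trans U2 _; rewrite -{1}(expn1 U); apply: pow_le.
    by rewrite muln_gt0 s0 andbT; lia.
  have := p2 e1; have := p2 e2; move: b1 b2.
  move: (U ^ (K * esize e1)) (U ^ (K * esize e2)) (eval e1 s) (eval e2 s).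
  move=> u v x y hx hy hv hu.
  have hxy : x <= u * v by apply: leq_trans hx _; apply: leq_pmulr; lia.
  case: o => /=; [nia| |exact: leq_mul|].
    by apply: leq_trans (leq_subr _ _) hxy.
  by apply: leq_trans (leq_div _ _) hxy.
- move=> /andP[ha _]; apply: leq_trans (h2 _ _ ha) _.
  by apply: pow_le; rewrite leq_pmulr.
Qed.

(** The strict inequality [esize e < Z] leaves a spare factor [U ^ K >= U ^ 7], which absorbs the
    multiplication by [narr] and the base address [X <= U ^ 4]. *)
Lemma addr_le e s a : bounded s -> ewf K e -> a < narr -> esize e < Z ->
  X + (eval e s * narr + a) <= B.
Proof.
move=> hs he ha hZ; have := eval_le hs he; set v := eval e s => hv.
have h1 : U ^ (K * esize e) * U ^ 7 <= B.
  rewrite -expnD; apply: pow_le; apply: leq_trans hcw.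
  have : K * (esize e).+1 <= K * Z by rewrite leq_mul2l hZ orbT.
  rewrite mulnS; lia.
apply: leq_trans h1; move: (U ^ (K * _)) hv (expn_gt0 U (K * esize e)) => y hv hy.
have {}hy : 0 < y by rewrite hy; lia.
have h7 : U ^ 7 = U ^ 4 * U ^ 3 by rewrite -expnD.
have h3 : 8 <= U ^ 3 by rewrite -[8]/(2 ^ 3) leq_exp2r.
have h4 : 16 <= U ^ 4 by rewrite -[16]/(2 ^ 4) leq_exp2r.
move: ha; rewrite /narr h7; move: (U ^ 4) (U ^ 3) hX h3 h4 => p q hp hq h4 ha.
have : p * 8 <= p * q by rewrite leq_mul2l hq orbT.
move: (p * q) => pq hpq.
have : y * pq >= y * (p * 8) by rewrite leq_mul2l hpq orbT.
nia.
Qed.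

Lemma steps_write i a v k pc0 m u s2 : writes_to i a v -> nth IHalt P pc0 = i ->
  v m <= B -> steps k (State pc0.+1 (upd m a (v m)) u) s2 ->
  steps k.+1 (State pc0 m u) s2.
Proof.
by move=> hw hi hv hs; rewrite -add1n; apply: steps_trans hs; apply: hw.
Qed.

Lemma steps_store a b k pc0 m u s2 : nth IHalt P pc0 = IStore a b ->
  m b <= B -> steps k (State pc0.+1 (upd m (m a) (m b)) u) s2 ->
  steps k.+1 (State pc0 m u) s2.
Proof. by move=> hi hv hs; rewrite -add1n; apply: steps_trans hs; apply: step_store. Qed.

(* Naming the written value [x] keeps memories linear in the number of steps. *)
Lemma steps_set x i a v k pc0 m u s2 : writes_to i a v -> nth IHalt P pc0 = i ->
  v m = x -> x <= B -> steps k (State pc0.+1 (upd m a x) u) s2 ->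
  steps k.+1 (State pc0 m u) s2.
Proof. by move=> hw hi <- hB hs; exact: (steps_write hw hi hB hs). Qed.

Lemma addr_code_ok a d off m u i :
  code_at off (addr_code a d) -> m d = i -> m rbase = X -> a < narr ->
  tmp0 <= d -> X + (i * narr + a) <= B ->
  exists m', [/\ steps 5 (State off m u)
      (State (off + 5) m' u),
    m' d = X + (i * narr + a) & forall x, x != d -> x != d.+1 -> m' x = m x].
Proof.
move=> hc hd hb ha hdt hB.
have /code_at_cons[c1 {}hc] := hc; have /code_at_cons[c2 {}hc] := hc.
have /code_at_cons[c3 {}hc] := hc; have /code_at_cons[c4 {}hc] := hc.
have /code_at_cons[c5 _] := hc.
have n1 : (d == d.+1) = false by lia.
have n2 : (rbase == d) = false by rewrite /rbase; rewrite /tmp0 in hdt; lia.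
have n3 : (rbase == d.+1) = false by rewrite /rbase; rewrite /tmp0 in hdt; lia.
have ha' : narr <= B.
  move: hXc hB; rewrite /ncell /narr; lia.
rewrite (_ : off + 5 = off.+4.+1); last lia.
eexists; split.
- apply: (steps_write (@step_const _ _) c1) => //.
  apply: (steps_write (@step_bop Mul _ _ _) c2) => /=.
    by rewrite /upd eqxx n1 hd; lia.
  apply: (steps_write (@step_const _ _) c3) => /=; first by lia.
  apply: (steps_write (@step_bop Add _ _ _) c4) => /=.
    by rewrite /upd ?eqxx n1 hd; lia.
  apply: (steps_write (@step_bop Add _ _ _) c5) => /=.
    by rewrite /upd ?eqxx n1 n2 n3 hb hd; lia.
  exact: steps0.
- by rewrite /= /upd !eqxx n1 n2 n3 hb hd addnC.
- by move=> x /negbTE h1 /negbTE h2; rewrite /= /upd h1 h2.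
Qed.

(** The frame condition protects both the pending operands and variables, below [d], and the arrays,
    from [ncell] on; so [sim] survives the first operand and the induction applies to the second. *)
Lemma cexp_ok e d off s m u :
  sim s m -> bounded s -> ewf K e -> esize e <= Z -> code_at off (cexp e d) ->
  tmp0 <= d -> d + edepth e <= ncell ->
  exists m', [/\ steps (size (cexp e d)) (State off m u)
      (State (off + size (cexp e d)) m' u),
    m' d = eval e s & forall x, (x < d) || (ncell <= x) -> m' x = m x].
Proof.
elim: e d off m => [x|v|o e1 IH1 e2 IH2|a e IH] d off m hs hb he hZ hc hd hD.
- have /code_at_cons[c1 _] := hc; case: (hs) => h1 h2 h3 h4 h5.
  rewrite /= in he hD *; eexists; split.
  + rewrite addn1; apply: (steps_write (@step_bop Add _ _ _) c1); last exact: steps0.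
    rewrite /= h2 addn0 h1 //; have [hr _] := hb; apply: leq_trans (hr _ he) _.
    apply: pow_le; apply: leq_trans hcw; exact: leq_pmulr.
  + by rewrite /= /upd eqxx h2 addn0 h1.
  + move=> y hy; rewrite /= /upd; case: eqP => // hyd; lia.
- have /code_at_cons[c1 _] := hc; rewrite /= in he hD *; eexists; split.
  + rewrite addn1; apply: (steps_write (@step_const _ _) c1); last exact: steps0.
    apply: leq_trans (const_le he) _; apply: pow_le; apply: leq_trans hcw.
    exact: leq_pmulr.
  + by rewrite /= /upd eqxx.
  + move=> y hy; rewrite /= /upd; case: eqP => // hyd; lia.
- have hBin := eval_le hb he.
  move: he hZ hD hc => /= /andP[he1 he2] hZ hD /code_at_cat[c1 /code_at_cat[c2 /code_at_cons[c3 _]]].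
  have [m1 [s1 v1 f1]] : exists m1, [/\ steps (size (cexp e1 d)) (State off m u)
      (State (off + size (cexp e1 d)) m1 u),
    m1 d = eval e1 s & forall x, (x < d) || (ncell <= x) -> m1 x = m x].
    by apply: IH1 => //; lia.
  have hs1 : sim s m1 by apply: (sim_frame hs) => x hx; apply: f1; lia.
  have [m2 [s2 v2 f2]] : exists m2, [/\ steps (size (cexp e2 d.+1)) (State (off + size (cexp e1 d)) m1 u)
      (State (off + size (cexp e1 d) + size (cexp e2 d.+1)) m2 u),
    m2 d.+1 = eval e2 s & forall x, (x < d.+1) || (ncell <= x) -> m2 x = m1 x].
    by apply: IH2 => //; lia.
  have v1' : m2 d = eval e1 s by rewrite f2 // ltnSn.
  exists (upd m2 d (bop_sem o (m2 d) (m2 d.+1))); rewrite !size_cat /= !addnA !addn1.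
  rewrite -addnS; split.
  + rewrite addnS -addn1; apply: steps_trans; first by apply: steps_trans s1 s2.
    apply: step_bop c3 _; rewrite v1' v2.
    apply: leq_trans hBin _; apply: pow_le; apply: leq_trans hcw.
    by rewrite leq_mul2l hZ orbT.
  + by rewrite /upd eqxx v1' v2.
  + move=> x hx; rewrite /upd; case: eqP => [hxd|_]; first lia.
    by rewrite f2 ?f1 //; lia.
- move: he hZ hD => /= /andP[ha he] hZ hD; move: hc.
  rewrite -[cexp (Get a e) d]/(cexp e d ++ (addr_code a d ++ [:: ILoad d d])).
  case/code_at_cat=> c1 /code_at_cat[c2 /code_at_cons[c3 _]].
  have [m1 [s1 v1 f1]] : exists m1, [/\ steps (size (cexp e d)) (State off m u)
      (State (off + size (cexp e d)) m1 u),
    m1 d = eval e s & forall x, (x < d) || (ncell <= x) -> m1 x = m x].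
    by apply: IH => //; lia.
  have hs1 : sim s m1 by apply: (sim_frame hs) => x hx; apply: f1; lia.
  have [_ _ _ hb1 ha1] := hs1.
  have [m2 [s2 v2 f2]] := addr_code_ok u c2 v1 hb1 ha hd (addr_le hb he ha hZ).
  have f3 : m2 (m2 d) = ar s a (eval e s).
    have : ncell <= m2 d by rewrite v2; apply: leq_trans hXc (leq_addr _ _).
    move=> hh; rewrite f2; [by rewrite v2 ha1| |]; lia.
  exists (upd m2 d (m2 (m2 d))); rewrite !size_cat /=; split.
  + have -> : off + (size (cexp e d) + 6) = (off + size (cexp e d) + 5).+1 by lia.
    have -> : size (cexp e d) + 6 = size (cexp e d) + 5 + 1 by lia.
    apply: steps_trans; first exact: (steps_trans s1 s2).
    apply: step_load c3 _; rewrite f3.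
    have [_ hr] := hb; apply: leq_trans (hr _ _ ha) _.
    apply: pow_le; apply: leq_trans hcw; exact: leq_pmulr.
  + by rewrite /upd eqxx f3.
  + move=> x hx; rewrite /upd; case: eqP => [hxd|_]; first lia.
    by rewrite f2 ?f1 //; lia.
Qed.
Lemma sim_setr s m x v : sim s m -> x < nvar -> sim (setr s x v) (upd m x v).
Proof.
case=> h1 h2 h3 h4 h5 hx; rewrite /nvar in hx.
have ne y : nvar <= y -> (y == x) = false by rewrite /nvar => ?; lia.
split=> [y hy||||a i ha] /=; rewrite /upd.
- by case: eqP => // _; apply: h1.
- by rewrite ne.
- by rewrite ne.
- by rewrite ne.
- rewrite ne; first exact: h5.
  by move: hXc; rewrite /ncell /nvar; lia.
Qed.

Lemma bounded_setr s x v : bounded s -> v <= V -> bounded (setr s x v).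
Proof.
case=> h1 h2 hv; split=> // y hy /=.
by rewrite /upd; case: eqP => // _; apply: h1.
Qed.

Lemma sim_seta s m a i v : sim s m -> a < narr ->
  sim (seta s a i v) (upd m (X + (i * narr + a)) v).
Proof.
case=> h1 h2 h3 h4 h5 ha.
have ne y : y < ncell -> (y == X + (i * narr + a)) = false by move: hXc; lia.
split=> [y hy||||b j hb] /=; rewrite /upd.
- rewrite ne; first exact: h1.
  by move: hy; rewrite /nvar /ncell; lia.
- by rewrite ne.
- by rewrite ne.
- by rewrite ne.
rewrite eqn_add2l; case: (b =P a) => [->|hba] /=.
  rewrite eqn_add2r eqn_pmul2r //; case: eqP => // _; exact: h5.
case: eqP => [|_]; last exact: h5.
(* Cells of different arrays never collide, as their offsets have different residues modulo
   [narr]. *)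
move=> /(congr1 (fun z => z %% narr)); rewrite !modnMDl !modn_small //.
Qed.

Lemma bounded_seta s a i v : bounded s -> v <= V -> bounded (seta s a i v).
Proof.
case=> h1 h2 hv; split=> // b j hb /=.
by case: (_ && _) => //; apply: h2.
Qed.

Lemma size_comp c off : size (comp c off) = csize c.
Proof.
elim: c off => [x e|a e1 e2|x|c1 IH1 c2 IH2|x y c IH] off //=;
  rewrite ?size_cat ?IH1 ?IH2 ?IH /=; lia.
Qed.

Lemma VB : V <= B.
Proof. by apply: pow_le; apply: leq_trans hcw; exact: leq_pmulr. Qed.

Lemma comp_ok c off s m :
  sim s m -> bounded s -> cwf K Z c -> ok V r c s -> code_at off (comp c off) ->
  exists m', [/\ steps (cost r c s) (State off m (us s))
                      (State (off + csize c) m' (us (run r c s))),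
    sim (run r c s) m' & bounded (run r c s)].
Proof.
elim: c off s m => [x e|a e1 e2|x|c1 IH1 c2 IH2|x y c IH] off s m hs hb.
- move=> /and4P[hx he hZ hD] hok /code_at_cat[k1 /code_at_cons[k2 _]].
  have [m1 [s1 v1 f1]] := cexp_ok (us s) hs hb he hZ k1 (leqnn _) hD.
  have hs1 : sim s m1 by apply: (sim_frame hs).
  have [_ h2 _ _ _] := hs1.
  exists (upd m1 x (eval e s)); split; last 2 first.
  + exact: sim_setr.
  + exact: bounded_setr.
  + have t := @step_bop Add _ _ _ _ m1 (us s) k2.
    rewrite /= v1 h2 addn0 in t.
    have := steps_trans s1 (t (leq_trans hok VB)).
    rewrite /=; congr steps; first lia.
    by congr State; lia.
- move=> /and5P[ha he1 he2 hZ1 /and3P[hZ2 hD2 hD1]] hok.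
  move=> /code_at_cat[k2 /code_at_cat[k1 /code_at_cat[k3 /code_at_cons[k4 _]]]].
  have [m1 [s1 v1 f1]] := cexp_ok (us s) hs hb he2 hZ2 k2 (leqnn _) hD2.
  have hs1 : sim s m1 by apply: (sim_frame hs).
  have hD1' : tmp0.+1 + edepth e1 <= ncell by lia.
  have [m2 [s2 v2 f2]] := cexp_ok (us s) hs1 hb he1 (ltnW hZ1) k1 (leqnSn _) hD1'.
  have hs2 : sim s m2.
    by apply: (sim_frame hs1) => z hz; apply: f2; apply/orP; case/orP: hz; lia.
  have v1' : m2 tmp0 = eval e2 s by rewrite f2.
  have [_ _ _ hb2 _] := hs2.
  have [m3 [s3 v3 f3]] := addr_code_ok (us s) k3 v2 hb2 ha (leqnSn _) (addr_le hb he1 ha hZ1).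
  have hs3 : sim s m3.
    by apply: (sim_frame hs2) => z hz; apply: f3; move: hz; rewrite /tmp0 /ncell; lia.
  have v1'' : m3 tmp0 = eval e2 s by rewrite f3.
  exists (upd m3 (X + (eval e1 s * narr + a)) (eval e2 s)); split; last 2 first.
  + exact: sim_seta.
  + exact: bounded_seta.
  + have s4 := step_store (us s) k4 (leq_trans (eq_leq v1'') (leq_trans hok VB)).
    have := steps_trans (steps_trans (steps_trans s1 s2) s3) s4.
    rewrite v3 v1'' /=; congr steps; first lia.
    by congr State; lia.
- move=> hx _ /code_at_cons[k1 _].
  exists (upd m x (nth false r (us s))); split.
  + by rewrite /= addn1; apply: step_rand.
  + exact: sim_setr.
  + apply: bounded_setr => //; apply: leq_trans (leq_b1 _) _.
    by rewrite expn_gt0; lia.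
- move=> /andP[w1 w2] [o1 o2] /code_at_cat[]; rewrite size_comp => k1 k2.
  have [m1 [s1 hs1 hb1]] := IH1 _ _ _ hs hb w1 o1 k1.
  have [m2 [s2 hs2 hb2]] := IH2 _ _ _ hs1 hb1 w2 o2 k2.
  exists m2; split=> //=; rewrite addnA; exact: steps_trans s1 s2.
- move=> /and5P[hx hy hxy hxw /andP[hyw hw]] hok.
  rewrite [comp _ _]/= => /code_at_cons[k1 /code_at_cons[k2 /code_at_cons[k3]]].
  move=> /code_at_cat[k4]; rewrite size_comp => /code_at_cons[k5 /code_at_cons[k6 _]].
  have hyx : y != x by rewrite eq_sym.
  have N1 : rg s y <= V by case: hb => h _; apply: h.
  (* The state is described each time the machine reaches the test at [off.+1]; the leading 1 pays
     for clearing the counter. *)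
  have main k : k <= rg s y -> exists m', 
      [/\ steps (1 + \sum_(i < k) (3 + cost r c (loop r x c s i))) (State off m (us s))
         (State off.+1 m' (us (loop r x c s k))),
       sim (loop r x c s k) m' & bounded (loop r x c s k)].
    elim: k => [_|k IHk hk].
      exists (upd m x 0); split; last 2 first.
      + exact: sim_setr.
      + exact: bounded_setr.
      + by rewrite big_ord0; apply: (step_const _ k1).
    have [m1 [s1 hs1 hb1]] := IHk (ltnW hk).
    rewrite -addn3 in k4.
    have [m2 [s2 hs2 hb2]] := IH _ _ _ hs1 hb1 hw (hok k hk) k4.
    have [h1 h2 h3 h4 h5] := hs2; have [g1 g2 g3 g4 g5] := hs1.
    have hxk : rg (run r c (loop r x c s k)) x = k.
      by rewrite rg_run // loop_counter.
    exists (upd m2 x k.+1); split; last 2 first.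
    + by rewrite /loop iterS -/(loop r x c s k) /succr hxk; apply: sim_setr.
    + rewrite /loop iterS -/(loop r x c s k) /succr hxk.
      by apply: bounded_setr => //; apply: leq_trans hk N1.
    + have t1 := step_jlt m1 (us (loop r x c s k)) k2.
      rewrite !g1 // loop_counter // loop_frame // hk in t1.
      have t2 := @step_bop Add _ _ _ _ m2 (us (run r c (loop r x c s k))) k5.
      rewrite /= h1 // hxk h3 addn1 in t2.
      have {}t2 := t2 (leq_trans (leq_trans hk N1) VB).
      have t3 := step_jlt (upd m2 x k.+1) (us (run r c (loop r x c s k))) k6.
      have n1 : (rzero == x) = false by move: hx; rewrite /nvar /rzero; lia.
      have n2 : (rone == x) = false by move: hx; rewrite /nvar /rone; lia.
      have q1 : upd m2 x k.+1 rzero = 0 by rewrite /upd n1.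
      have q2 : upd m2 x k.+1 rone = 1 by rewrite /upd n2.
      rewrite q1 q2 /= in t3.
      have e3 : off + 3 + csize c = off.+3 + csize c by lia.
      rewrite e3 in s2.
      have := steps_trans (steps_trans (steps_trans s1 t1) s2) (steps_trans t2 t3).
      rewrite big_ord_recr /=; congr steps; first lia.
      by congr State; lia.
  have [m1 [s1 hs1 hb1]] := main _ (leqnn _).
  exists m1; split=> //.
  have t1 := step_jlt m1 (us (loop r x c s (rg s y))) k2.
  have [g1 g2 g3 g4 g5] := hs1.
  rewrite !g1 // loop_counter // loop_frame // ltnn in t1.
  have t2 := step_jlt m1 (us (loop r x c s (rg s y))) k3.
  rewrite g2 g3 /= in t2.
  have := steps_trans (steps_trans s1 t1) t2.
  rewrite /=; congr steps; lia.
Qed.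
End Compiler.

(** * Relocating the input *)

(* No cell is free at the start: the registers overlap the input.  With a = 2n
   and X = a^4, the single number Y = W * X + a encodes both n and W, and X is
   an address beyond the input; so Y is saved at X, which frees the first two
   cells for moving the other ones. *)
Definition prologue : seq instr :=
  [:: IAdd 0 0 0; IMul 1 1 0; IMul 1 1 0; IMul 1 1 0; IMul 1 1 0; IAdd 1 1 0;
      IMul 0 0 0; IMul 0 0 0; IStore 0 1; IConst 1 narr; IAdd 0 0 1]
  ++ flatten [seq [:: IAdd 0 0 1; IStore 0 j] | j <- iota 2 34]
  ++ [:: IConst 2 105; ISub 0 0 2; IConst rzero 0; IConst rone 1;
         IAdd rbase 0 rzero; ILoad 1 rbase; IDiv 2 1 rbase; IMul 3 2 rbase;
         ISub 1 1 3; IConst 24 36; IConst 25 2; IAdd 25 25 1; IConst 28 3;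
         IConst 26 108; IAdd 26 26 rbase;
         IJlt 24 25 96; IJlt rzero rone 101;
         ILoad 27 24; IStore 26 27; IAdd 26 26 28; IAdd 24 24 rone;
         IJlt rzero rone 94; IConst 24 2; IDiv 1 1 24].

Section Prologue.
Variables (rest : seq instr) (r : seq bool) (U cw n W : nat) (m0 : nat -> nat).
Local Notation P := (prologue ++ rest).
Local Notation B := (U ^ cw).
Local Notation X := ((n + n) ^ 4).
Local Notation Y := (W * X + (n + n)).
Hypothesis n1 : 1 < n.
Hypothesis nU : n + n + 2 <= U.
Hypothesis WU : W <= U.
Hypothesis mU : forall z, m0 z <= U.
Hypothesis m0n : m0 0 = n.
Hypothesis m0W : m0 1 = W.
Hypothesis m0z : forall z, n + n + 2 <= z -> m0 z = 0.
Hypothesis cw7 : 6 < cw.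

Local Notation steps := (steps P r U cw).

(** Contents of address [X + o] once the input cells below [j] are copied. Array 0 occupies the
    multiples of [narr = 3] and keeps the original indices; [Y] sits at index 0. *)
Definition moved j o :=
  if o == 0 then Y else if (3 %| o) && (1 < o %/ 3 < j) then m0 (o %/ 3) else 0.

Lemma moved_step j o : 1 < j ->
  moved j.+1 o = if o == j * 3 then m0 j else moved j o.
Proof.
move=> hj; rewrite /moved; case: (o =P j * 3) => [->|ho].
  rewrite dvdn_mull // mulnK // ltnSn hj /= muln_eq0; by case: j hj.
case: eqP => // _; case: (boolP (3 %| o)) => //= /dvdnP[q hq].
rewrite hq mulnK //; congr (if _ then _ else _).
have : q != j by apply/eqP=> e; apply: ho; rewrite hq e.
lia.
Qed.

Lemma X_ge : 256 <= X.
Proof. by rewrite -[256]/(4 ^ 4) leq_exp2r //; lia. Qed.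

(** Everything from [X] on is therefore initially zero, so arrays 1 and 2 start empty. *)
Lemma X_input : n + n + 2 <= X.
Proof.
apply: (@leq_trans ((n + n) ^ 2)); last by rewrite leq_exp2l; lia.
by rewrite -mulnn; nia.
Qed.

Lemma X_le : X <= U ^ 4.
Proof. by rewrite leq_exp2r //; lia. Qed.

Lemma Y_le : Y <= U ^ 6.
Proof.
have -> : U ^ 6 = U ^ 4 * (U * U) by rewrite mulnn -expnD.
have hu : U <= U ^ 4 by rewrite -{1}(expn1 U) leq_exp2l; lia.
have h1 : W * X <= U * U ^ 4 by apply: leq_mul => //; exact: X_le.
have h2 : 2 <= U by lia.
have h3 : U ^ 4 * (U + 1) <= U ^ 4 * (U * U) by rewrite leq_mul2l; apply/orP; right; nia.
apply: leq_trans h3; rewrite mulnDr muln1 [U ^ 4 * U]mulnC; apply: leq_add => //.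
by apply: leq_trans hu; lia.
Qed.

Lemma small_le k v : k <= 6 -> v <= U ^ k -> v <= B.
Proof.
move=> hk hv; apply: leq_trans hv _; rewrite leq_exp2l; lia.
Qed.

Lemma addr_small j : j <= U * U -> X + j * 3 <= B.
Proof.
move=> hj; apply: (@small_le 6) => //; have := X_le.
have -> : U ^ 6 = U ^ 4 * (U * U) by rewrite mulnn -expnD.
have hu : U * U <= U ^ 4 by rewrite mulnn leq_exp2l; lia.
have h2 : 3 * 3 <= U * U by apply: leq_mul; lia.
have h3 : U ^ 4 * 9 <= U ^ 4 * (U * U) by rewrite leq_mul2l h2 orbT.
by lia.
Qed.

Definition moving j (m : nat -> nat) :=
  (forall z, 1 < z -> z < X -> m z = m0 z) /\ (forall o, m (X + o) = moved j o).

(** Two cells suffice: cell 1 is multiplied four times by [a = 2 n] from cell 0 and then receives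
    [+ a]; only afterwards is cell 0 squared twice to become the address [X]. *)
Lemma prologue_start : exists m, steps 11 (State 0 m0 0) (State 11 m 0) /\
  [/\ m 0 = X + 3, m 1 = 3 & moving 2 m].
Proof.
have e4 : X = (n + n) * (n + n) * ((n + n) * (n + n)) by rewrite !expnS expn0; lia.
have hX := X_ge; have hX' := X_input; have hY := Y_le; have hX4 := X_le.
have l6 v : v <= Y -> v <= B by move=> h; apply: (@small_le 6) => //; lia.
have h3 : X + 3 <= B by apply: (@addr_small 1); nia.
have lX v : v <= X -> v <= B by move=> h; lia.
have [a ha] : exists a, a = n + n by exists (n + n).
have ea : forall k, k <= 4 -> W * a ^ k <= Y.
  move=> k hk; rewrite ha; apply: leq_trans (leq_addr _ _).
  by rewrite leq_mul2l leq_exp2l ?hk ?orbT //; lia.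
have a2 : a <= a * a by nia.
have a4 : a * a <= X by rewrite ha e4; nia.
have n0 : 0 == X = false by lia.
have n1' : 1 == X = false by lia.
eexists; split.
- apply: (@steps_set _ _ _ _ (n + n) _ _ _ _ _ _ _ _ (@step_bop P r U cw Add _ _ _));
    [exact: erefl | by rewrite /= m0n | by apply: lX; lia |].
  apply: (@steps_set _ _ _ _ (W * (n + n) ^ 1) _ _ _ _ _ _ _ _ (@step_bop P r U cw Mul _ _ _));
    [exact: erefl | by rewrite /upd /= ?m0W -?mulnA -?expnSr | by rewrite -ha; apply: l6; exact: ea |].
  apply: (@steps_set _ _ _ _ (W * (n + n) ^ 2) _ _ _ _ _ _ _ _ (@step_bop P r U cw Mul _ _ _));
    [exact: erefl | by rewrite /upd /= ?m0W -?mulnA -?expnSr | by rewrite -ha; apply: l6; exact: ea |].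
  apply: (@steps_set _ _ _ _ (W * (n + n) ^ 3) _ _ _ _ _ _ _ _ (@step_bop P r U cw Mul _ _ _));
    [exact: erefl | by rewrite /upd /= ?m0W -?mulnA -?expnSr | by rewrite -ha; apply: l6; exact: ea |].
  apply: (@steps_set _ _ _ _ (W * (n + n) ^ 4) _ _ _ _ _ _ _ _ (@step_bop P r U cw Mul _ _ _));
    [exact: erefl | by rewrite /upd /= ?m0W -?mulnA -?expnSr | by rewrite -ha; apply: l6; exact: ea |].
  apply: (@steps_set _ _ _ _ (Y) _ _ _ _ _ _ _ _ (@step_bop P r U cw Add _ _ _));
    [exact: erefl | by rewrite /upd /= | by apply: l6 |].
  apply: (@steps_set _ _ _ _ ((n + n) * (n + n)) _ _ _ _ _ _ _ _ (@step_bop P r U cw Mul _ _ _));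
    [exact: erefl | by rewrite /upd /= | by rewrite -ha; apply: lX; exact: a4 |].
  apply: (@steps_set _ _ _ _ (X) _ _ _ _ _ _ _ _ (@step_bop P r U cw Mul _ _ _));
    [exact: erefl | by rewrite /upd /= -e4 | by apply: lX |].
  apply: steps_store; [exact: erefl | by apply: l6 |].
  apply: (@steps_set _ _ _ _ (3) _ _ _ _ _ _ _ _ (@step_const P r U cw _ _));
    [exact: erefl | by rewrite // | by exact: leq_trans (leq_addl _ _) h3 |].
  apply: (@steps_set _ _ _ _ (X + 3) _ _ _ _ _ _ _ _ (@step_bop P r U cw Add _ _ _));
    [exact: erefl | by rewrite /upd /= n0 | by [] |].
  exact: steps0.
- split; rewrite /upd //=; split=> [z hz hzX|o].
    have hz0 : (z == 0) = false by lia.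
    have hz1 : (z == 1) = false by lia.
    have hzX' : (z == X) = false by lia.
    by rewrite ?(hz0, hz1, hzX').
  have hz0 : (X + o == 0) = false by lia.
  have hz1 : (X + o == 1) = false by lia.
  rewrite ?(hz0, hz1) -[X in _ == X]addn0 eqn_add2l /moved; case: eqP => // ho.
  by rewrite m0z; [case: ifP => //; lia | lia].
Qed.

(** The cells 2 to 35, which become registers and scratch space, are moved by straight-line code,
    because a copying loop needs registers of its own. *)
Lemma prologue_save k : k <= 34 -> exists m, steps (11 + k * 2) (State 0 m0 0) (State (11 + k * 2) m 0) /\
  [/\ m 0 = X + (1 + k) * 3, m 1 = 3 & moving (2 + k) m].
Proof.
elim: k => [_|k IH hk]; first exact: prologue_start.
have [m [s1 [h0 h1 [h2 h3]]]] := IH (ltnW hk).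
have hX := X_ge; have hX' := X_input.
have q1 : nth IHalt P (11 + k * 2) = IAdd 0 0 1.
  by move: k hk {IH s1 h0 h2 h3}; do 34![case=> [|] //].
have q2 : nth IHalt P (11 + k * 2).+1 = IStore 0 (2 + k).
  by move: k hk {IH s1 h0 h2 h3 q1}; do 34![case=> [|] //].
exists (upd (upd m 0 (X + (2 + k) * 3)) (X + (2 + k) * 3) (m0 (2 + k))).
have ne z : z < X -> (z == X + (2 + k) * 3) = false by lia.
split; first last.
  rewrite /upd /= !ne //; try lia; split=> //; split=> [z hz hzX|o].
    by rewrite ne //; case: eqP => [?|_]; [lia | apply: h2].
  rewrite moved_step // eqn_add2l; case: eqP => // _.
  by case: eqP => [?|_]; [lia | apply: h3].
rewrite (_ : 11 + k.+1 * 2 = 11 + k * 2 + 2); last lia.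
apply: steps_trans s1 _.
rewrite (_ : 11 + k * 2 + 2 = (11 + k * 2).+2); last lia.
set A := X + (2 + k) * 3.
have eA : upd m 0 A (2 + k) = m0 (2 + k) by rewrite /upd /= h2; lia.
have bA : upd m 0 A (2 + k) <= B.
  by rewrite eA; apply: (@small_le 1) => //; rewrite expn1.
apply: (@steps_set _ _ _ _ A _ _ _ _ _ _ _ _ (@step_bop P r U cw Add _ _ _));
  [exact: q1 | by rewrite /= h0 h1 /A; lia | by apply: addr_small; nia |].
by have := step_store r 0 q2 bA; rewrite eA.
Qed.

(** Cell 0 has reached [X + 35 * 3], so subtracting 105 recovers [X]; then [Y %/ X = W] because
    [2 n < X]. Variables not yet assigned still hold input numbers, which the bound [U ^ 6]
    covers. *)
Lemma prologue_regs : exists m, steps 94 (State 0 m0 0) (State 94 m 0) /\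
  [/\ m 2 = W, m 24 = 36 & m 25 = n + n + 2] /\
  [/\ m 1 = n + n, m 28 = 3 & m 26 = X + 36 * 3] /\
  [/\ m rzero = 0, m rone = 1, m rbase = X & forall x, x < nvar -> m x <= U ^ 6] /\
  (forall z, 36 <= z -> z < X -> m z = m0 z) /\ (forall o, m (X + o) = moved 36 o).
Proof.
have [m [s1 [h0 h1 [h2 h3]]]] := @prologue_save 34 (leqnn _).
have hX := X_ge; have hX' := X_input; have hY := Y_le; have hX4 := X_le.
have l6 v : v <= Y -> v <= B by move=> h; apply: (@small_le 6) => //; lia.
have lX v : v <= X -> v <= B by move=> h; apply: (@small_le 4) => //; lia.
have X0 : 0 < X by lia.
have hWX : W <= W * X by apply: leq_pmulr.
have h36 : 36 <= B by apply: lX; lia.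
have h105 : 105 <= B by apply: lX; lia.
have h108 : 108 <= B by apply: lX; lia.
have n0 : X == 0 = false by lia.
have n1' : X == 1 = false by lia.
have n2' : X == 2 = false by lia.
have n3' : X == 21 = false by lia.
have n4' : X == 22 = false by lia.
have n5' : X == 23 = false by lia.
have hYX : Y %/ X = W by rewrite divnMDl // divn_small ?addn0 //; lia.
have mX : m X = Y by have := h3 0; rewrite addn0.
have U6 v : v <= U -> v <= U ^ 6.
  by move=> h; apply: leq_trans h _; rewrite -{1}(expn1 U) leq_exp2l; lia.
eexists; split; last split; last split; last split.
- apply: (@steps_trans _ _ _ _ 79 15) s1 _.
  apply: (@steps_set _ _ _ _ (105) _ _ _ _ _ _ _ _ (@step_const P r U cw _ _));
    [exact: erefl | by rewrite /upd /= ?h0 ?h1 ?n0 ?n1' ?n2' ?n3' ?n4' ?n5' ?mX //  | by [] |].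
  apply: (@steps_set _ _ _ _ (X) _ _ _ _ _ _ _ _ (@step_bop P r U cw Sub _ _ _));
    [exact: erefl | by rewrite /upd /= ?h0 ?h1 ?n0 ?n1' ?n2' ?n3' ?n4' ?n5' ?mX // ; lia | by apply: lX |].
  apply: (@steps_set _ _ _ _ (0) _ _ _ _ _ _ _ _ (@step_const P r U cw _ _));
    [exact: erefl | by rewrite /upd /= ?h0 ?h1 ?n0 ?n1' ?n2' ?n3' ?n4' ?n5' ?mX //  | by [] |].
  apply: (@steps_set _ _ _ _ (1) _ _ _ _ _ _ _ _ (@step_const P r U cw _ _));
    [exact: erefl | by rewrite /upd /= ?h0 ?h1 ?n0 ?n1' ?n2' ?n3' ?n4' ?n5' ?mX //  | by apply: lX |].
  apply: (@steps_set _ _ _ _ (X) _ _ _ _ _ _ _ _ (@step_bop P r U cw Add _ _ _));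
    [exact: erefl | by rewrite /upd /= ?h0 ?h1 ?n0 ?n1' ?n2' ?n3' ?n4' ?n5' ?mX // addn0 | by apply: lX |].
  apply: (@steps_set _ _ _ _ (Y) _ _ _ _ _ _ _ _ (@step_load P r U cw _ _));
    [exact: erefl | by rewrite /upd /= ?h0 ?h1 ?n0 ?n1' ?n2' ?n3' ?n4' ?n5' ?mX //  | by apply: l6 |].
  apply: (@steps_set _ _ _ _ (W) _ _ _ _ _ _ _ _ (@step_bop P r U cw Div _ _ _));
    [exact: erefl | by rewrite /upd /= ?h0 ?h1 ?n0 ?n1' ?n2' ?n3' ?n4' ?n5' ?mX //  | by apply: l6; lia |].
  apply: (@steps_set _ _ _ _ (W * X) _ _ _ _ _ _ _ _ (@step_bop P r U cw Mul _ _ _));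
    [exact: erefl | by rewrite /upd /= ?h0 ?h1 ?n0 ?n1' ?n2' ?n3' ?n4' ?n5' ?mX //  | by apply: l6; lia |].
  apply: (@steps_set _ _ _ _ (n + n) _ _ _ _ _ _ _ _ (@step_bop P r U cw Sub _ _ _));
    [exact: erefl | by rewrite /upd /= ?h0 ?h1 ?n0 ?n1' ?n2' ?n3' ?n4' ?n5' ?mX // ; lia | by apply: lX; lia |].
  apply: (@steps_set _ _ _ _ (36) _ _ _ _ _ _ _ _ (@step_const P r U cw _ _));
    [exact: erefl | by rewrite /upd /= ?h0 ?h1 ?n0 ?n1' ?n2' ?n3' ?n4' ?n5' ?mX //  | by [] |].
  apply: (@steps_set _ _ _ _ (2) _ _ _ _ _ _ _ _ (@step_const P r U cw _ _));
    [exact: erefl | by rewrite /upd /= ?h0 ?h1 ?n0 ?n1' ?n2' ?n3' ?n4' ?n5' ?mX //  | by apply: lX; lia |].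
  apply: (@steps_set _ _ _ _ (n + n + 2) _ _ _ _ _ _ _ _ (@step_bop P r U cw Add _ _ _));
    [exact: erefl | by rewrite /upd /= ?h0 ?h1 ?n0 ?n1' ?n2' ?n3' ?n4' ?n5' ?mX // ; lia | by apply: lX; lia |].
  apply: (@steps_set _ _ _ _ (3) _ _ _ _ _ _ _ _ (@step_const P r U cw _ _));
    [exact: erefl | by rewrite /upd /= ?h0 ?h1 ?n0 ?n1' ?n2' ?n3' ?n4' ?n5' ?mX //  | by apply: lX; lia |].
  apply: (@steps_set _ _ _ _ (108) _ _ _ _ _ _ _ _ (@step_const P r U cw _ _));
    [exact: erefl | by rewrite /upd /= ?h0 ?h1 ?n0 ?n1' ?n2' ?n3' ?n4' ?n5' ?mX //  | by [] |].
  apply: (@steps_set _ _ _ _ (X + 36 * 3) _ _ _ _ _ _ _ _ (@step_bop P r U cw Add _ _ _));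
    [exact: erefl | by rewrite /upd /= ?h0 ?h1 ?n0 ?n1' ?n2' ?n3' ?n4' ?n5' ?mX // ; lia | by apply: addr_small; nia |].
  exact: steps0.
- by split; rewrite /upd.
- by split; rewrite /upd.
- split; rewrite /upd //=; move=> x; rewrite /nvar => hx.
  have X6 : X + 36 * 3 <= U ^ 6.
    have : U ^ 4 * 36 <= U ^ 6.
      by rewrite (_ : 6 = 4 + 2) // expnD leq_mul2l -[36]/(6 ^ 2) leq_exp2r //; lia.
    lia.
  do 15!(case: ifP => [_|/eqP ?]; first by (lia || (apply: U6; lia))).
  by rewrite h2; [exact: U6 | lia | lia].
- split=> [z hz hzX|o]; rewrite /upd /=.
    do 15!(case: ifP => [/eqP ?|_]; first (unfold rzero, rone, rbase in *; lia)).
    by apply: h2; lia.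
  do 15!(case: ifP => [/eqP ?|_]; first (unfold rzero, rone, rbase in *; lia)).
  exact: h3.
Qed.

Definition copying j m :=
  [/\ m 1 = n + n, m 2 = W, m 28 = 3 & m 26 = X + j * 3] /\
  [/\ m 24 = j, m 25 = n + n + 2, m rzero = 0, m rone = 1 & m rbase = X] /\
  [/\ forall x, x < nvar -> m x <= U ^ 6,
      forall z, 36 <= z -> z < X -> m z = m0 z & forall o, m (X + o) = moved j o].

Lemma copy_step j m : 36 <= j -> j < n + n + 2 -> copying j m ->
  exists m', steps 6 (State 94 m 0) (State 94 m' 0) /\ copying j.+1 m'.
Proof.
move=> j36 jn [[h1 h2 h28 h26] [[h24 h25 hz ho hb] [hr hlow hhigh]]].
have hX := X_ge; have hX' := X_input; have jU : j.+1 <= U * U by nia.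
have hA' := addr_small jU.
have hA : X + j * 3 <= B by apply: leq_trans hA'; lia.
have hv : m0 j <= B by apply: (@small_le 1) => //; rewrite expn1.
have hj : j.+1 <= B by apply: leq_trans hA'; lia.
have ne z : z < X -> (z == X + j * 3) = false by lia.
have ej : (X + j * 3 == 27) = false by lia.
have ho' : m 22 = 1 by [].
eexists; split.
- apply: (@steps_trans _ _ _ _ 1 5 _ (State 96 m 0)).
    have := step_jlt r U cw m 0 (erefl : nth IHalt P 94 = _).
    by rewrite /= h24 h25 jn; apply.
  apply: (@steps_set _ _ _ _ (m0 j) _ _ _ _ _ _ _ _ (@step_load P r U cw _ _));
    [exact: erefl | by rewrite h24 hlow //; lia | by [] |].
  apply: steps_store; [exact: erefl | by rewrite /upd |].
  rewrite [upd m 27 (m0 j) 26]/upd /= h26 {2}/upd /=.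
  apply: (@steps_set _ _ _ _ (X + j.+1 * 3) _ _ _ _ _ _ _ _ (@step_bop P r U cw Add _ _ _));
    [exact: erefl | by rewrite /upd /= !ne ?h26 ?h28; lia | by [] |].
  apply: (@steps_set _ _ _ _ j.+1 _ _ _ _ _ _ _ _ (@step_bop P r U cw Add _ _ _));
    [exact: erefl | by rewrite /upd /rone /= !ne ?h24 ?ho'; lia | by [] |].
  have := @step_jlt P r U cw 100
    (upd (upd (upd (upd m 27 (m0 j)) (X + j * 3) (m0 j)) 26 (X + j.+1 * 3)) 24 j.+1)
    0 _ _ _ (erefl : nth IHalt P 100 = _).
  have -> : upd (upd (upd (upd m 27 (m0 j)) (X + j * 3) (m0 j)) 26 (X + j.+1 * 3)) 24 j.+1 rzero = 0.
    by rewrite /upd /= ne //; rewrite /rzero; lia.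
  have -> : upd (upd (upd (upd m 27 (m0 j)) (X + j * 3) (m0 j)) 26 (X + j.+1 * 3)) 24 j.+1 rone = 1.
    by rewrite /upd /= ne //; rewrite /rone; lia.
  exact.
- split; first by split; rewrite /upd /= ?ne //; lia.
  split; first by split; rewrite /upd /= ?ne //; rewrite /rzero /rone /rbase; lia.
  rewrite /upd; split=> [x hx|z hz36 hzX|o].
  + rewrite ne; last by move: hx; rewrite /nvar; lia.
    by do 3!(case: ifP => [/eqP ?|_]; first (unfold nvar in *; lia)); apply: hr.
  + rewrite ne //.
    by do 3!(case: ifP => [/eqP ?|_]; first lia); apply: hlow.
  + do 2!(case: ifP => [/eqP ?|_]; first lia).
    rewrite eqn_add2l moved_step; last lia.
    by case: ifP => // _; case: ifP => [/eqP ?|_]; [lia | apply: hhigh].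
Qed.

Lemma prologue_ok K : 5 < K ->
  exists m k, [/\ k <= 200 + n * 12, steps k (State 0 m0 0) (State 103 m 0),
   m 1 = n /\ m 2 = W &
   let s := Store m (fun a i => if a == 0 then if i == 0 then Y else
                                 if i == 1 then 0 else m0 i else 0) 0 in
   sim X s m /\ bounded U K s].
Proof.
move=> hK.
have hX := X_ge; have hX' := X_input; have hY := Y_le; have hX4 := X_le.
have [m [s1 [[a1 a2 a3] [[b1 b2 b3] [[c1 c2 c3 c4] [d1 d2]]]]]] := prologue_regs.
have loop d : d <= n + n + 2 - 36 -> exists m', steps (94 + d * 6) (State 0 m0 0) (State 94 m' 0)
    /\ copying (36 + d) m'.
  elim: d => [_|d IH hd]; first by exists m.
  have [m1 [t1 q1]] := IH (ltnW hd).
  have hlt : 36 + d < n + n + 2 by lia.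
  have [m2 [t2 q2]] := copy_step (leq_addr _ _) hlt q1.
  exists m2; rewrite addnS; split=> //.
  rewrite (_ : 94 + d.+1 * 6 = 94 + d * 6 + 6); last lia.
  exact: steps_trans t1 t2.
have {loop} [m1 [t1 q1]] := loop _ (leqnn _).
set j := 36 + (n + n + 2 - 36) in q1.
have {s1 a1 a2 a3 b1 b2 b3 c1 c2 c3 c4 d1 d2 m} hj : n + n + 2 <= j by rewrite /j; lia.
have [[h1 h2 h28 h26] [[h24 h25 hz ho hb] [hr hlow hhigh]]] := q1.
have hn : n <= U ^ 6 by apply: (@leq_trans (U ^ 1)); [rewrite expn1 | rewrite leq_exp2l]; lia.
have s2 : steps 4 (State 94 m1 0) (State 103 (upd (upd m1 24 2) 1 n) 0).
  apply: (@steps_trans _ _ _ _ 1 3 _ (State 95 m1 0)).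
    have := step_jlt r U cw m1 0 (erefl : nth IHalt P 94 = _).
    by rewrite /= h24 h25 ltnNge hj; apply.
  apply: (@steps_trans _ _ _ _ 1 2 _ (State 101 m1 0)).
    have := step_jlt r U cw m1 0 (erefl : nth IHalt P 95 = _).
    by rewrite /= hz ho; apply.
  apply: (@steps_set _ _ _ _ 2 _ _ _ _ _ _ _ _ (@step_const P r U cw _ _));
    [exact: erefl | by [] | by apply: (@small_le 4) => //; lia |].
  apply: (@steps_set _ _ _ _ n _ _ _ _ _ _ _ _ (@step_bop P r U cw Div _ _ _));
    [exact: erefl | by rewrite /upd /= h1 addnn divn2 doubleK | exact: (@small_le 6) |].
  exact: steps0.
have U6 v : v <= U ^ 6 -> v <= U ^ K.
  by move=> h; apply: leq_trans h _; rewrite leq_exp2l; lia.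
exists (upd (upd m1 24 2) 1 n), (94 + (n + n + 2 - 36) * 6 + 4); split.
- lia.
- exact: steps_trans t1 s2.
- by [].
- move=> s; split; split.
  + by [].
  + by [].
  + by [].
  + by [].
  + move=> a i; rewrite /narr => ha; rewrite /s /= /upd.
    do 2!(case: ifP => [/eqP ?|_]; first lia).
    rewrite hhigh /moved.
    case: (a =P 0) => [->|a0].
      rewrite addn0 muln_eq0 /= orbF dvdn_mull // mulnK //=.
      case: (i =P 0) => // i0; case: (i =P 1) => [->|i1] //=.
      case: ifP => // hi; rewrite m0z //; lia.
    have -> : (i * 3 + a == 0) = false by lia.
    by rewrite (_ : 3 %| i * 3 + a = false) //; lia.
  + move=> x hx; rewrite /s /= /upd; case: ifP => [_|_]; first exact: U6.
    case: ifP => [/eqP ?|_]; first by unfold nvar in *; lia.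
    by apply: U6; apply: hr.
  + move=> a i _; rewrite /s /=; case: ifP => // _; case: ifP => [_|_]; first exact: U6.
    case: ifP => // _; apply: U6; apply: (leq_trans (mU i)).
    by rewrite -{1}(expn1 U) leq_exp2l; lia.
Qed.

End Prologue.

(** * The knapsack program *)

Section Spec.
Variables (V : nat) (r : seq bool).

Definition spec c s (Q : store -> Prop) k :=
  [/\ ok V r c s, Q (run r c s) & cost r c s <= k].

Lemma spec_seq c1 c2 s Q1 Q2 k1 k2 :
  spec c1 s Q1 k1 -> (forall s1, Q1 s1 -> spec c2 s1 Q2 k2) ->
  spec (Seq c1 c2) s Q2 (k1 + k2).
Proof.
case=> o1 q1 h1 h2; have [o2 q2 hk2] := h2 _ q1.
by split=> //=; apply: leq_add.
Qed.

Lemma spec_weak c s (Q1 Q2 : store -> Prop) k1 k2 :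
  spec c s Q1 k1 -> (forall s1, Q1 s1 -> Q2 s1) -> k1 <= k2 -> spec c s Q2 k2.
Proof. by case=> o q h hq hk; split=> //; [apply: hq | apply: leq_trans h hk]. Qed.

Lemma spec_cost c s Q k1 k2 : spec c s Q k1 -> k1 <= k2 -> spec c s Q k2.
Proof. by move=> h; apply: spec_weak h _. Qed.

Lemma spec_frame c s (Q : store -> Prop) k : spec c s Q k ->
  spec c s (fun s1 => Q s1 /\ forall z, z \notin writes c -> rg s1 z = rg s z) k.
Proof. by case=> o q h; split=> //; split=> // z; apply: rg_run. Qed.

(** Variables that the body does not write are known to be unchanged, so an invariant need only
    mention what varies. *)
Lemma spec_for x y c s (I : nat -> store -> Prop) g :
  x \notin writes c ->
  I 0 (setr s x 0) ->
  (forall k s1, k < rg s y -> rg s1 x = k ->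
     (forall z, z \notin x :: writes c -> rg s1 z = rg s z) -> I k s1 ->
     spec c s1 (fun s2 => I k.+1 (succr s2 x)) (g k)) ->
  spec (For x y c) s (I (rg s y)) (3 + \sum_(k < rg s y) (3 + g k)).
Proof.
move=> hx h0 hS.
have hI k : k <= rg s y -> I k (loop r x c s k) /\
    (forall j, j < k -> ok V r c (loop r x c s j) /\ cost r c (loop r x c s j) <= g j).
  elim: k => [|k IHk] hk; first by split.
  have [Ik hj] := IHk (ltnW hk).
  have [|o q h] := hS k (loop r x c s k) hk (loop_counter _ _ _ hx) _ Ik.
    by move=> z; rewrite inE negb_or => /andP[? ?]; rewrite loop_frame.
  split; first exact: q.
  by move=> j; rewrite ltnS leq_eqVlt => /orP[/eqP->|/hj].
have [q hj] := hI _ (leqnn _); split=> //.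
- by move=> k hk; case: (hj k hk).
- rewrite /= leq_add2l; apply: leq_sum => k _; rewrite leq_add2l.
  by case: (hj k (ltn_ord k)).
Qed.
End Spec.

Notation vans := 0 (only parsing).
Notation vn := 1 (only parsing).
Notation vW := 2 (only parsing).
Notation vi := 3 (only parsing).
Notation vsw := 4 (only parsing).
Notation vwm := 5 (only parsing).
Notation vM := 6 (only parsing).
Notation vL := 7 (only parsing).
Notation vkey := 8 (only parsing).
Notation vl := 9 (only parsing).
Notation vb := 10 (only parsing).
Notation vt := 11 (only parsing).
Notation vD := 12 (only parsing).
Notation vcnt := 13 (only parsing).
Notation vlo := 14 (only parsing).
Notation vc := 15 (only parsing).
Notation vj := 16 (only parsing).
Notation vst := 17 (only parsing).
Notation vw := 18 (only parsing).
Notation vp := 19 (only parsing).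
Notation vv := 20 (only parsing).

Declare Scope prog_scope.
Delimit Scope prog_scope with P.
Notation "a + b" := (Bin Add a b) : prog_scope.
Notation "a - b" := (Bin Sub a b) : prog_scope.
Notation "a * b" := (Bin Mul a b) : prog_scope.
Notation "a / b" := (Bin Div a b) : prog_scope.
Notation "# x" := (Var x) (at level 5, x at level 4, format "# x") : prog_scope.
Notation "$ x" := (Cst x) (at level 5, x at level 4, format "$ x") : prog_scope.
Notation "x :<- e" := (Asg x e%P) (at level 85) : prog_scope.
Notation "c1 ;; c2" := (Seq c1 c2) (at level 90, right associativity) : prog_scope.
Local Open Scope prog_scope.

Definition in_w := Get 0 ($2 + $2 * #vi)%P.
Definition in_p := Get 0 ($3 + $2 * #vi)%P.
(* m + (e - m) is max(m, e) *)
Definition emax m e := (m + (e - m))%P.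

Definition sum_body :=
  vw :<- in_w ;; vsw :<- #vsw + #vw ;; vwm :<- emax #vwm #vw.
(** [W - (W - sw)] is the minimum of [W] and [sw]. Capping the capacity gives
    [W' <= n * wm <= M * M * wm], which limits the drift of the window from one bucket to the
    next. *)
Definition sum_phase :=
  vsw :<- $0 ;; vwm :<- $0 ;; For vi vn sum_body ;; vW :<- #vW - (#vW - #vsw).
(* vb = [M * M < n]: M becomes the least power of 2 with n <= M * M. *)
Definition log_body :=
  vb :<- $1 - ($1 - (#vn - #vM * #vM)) ;; vM :<- #vM + #vb * #vM ;; vL :<- #vL + #vb.
Definition log_phase := vM :<- $1 ;; vL :<- $0 ;; For vi vn log_body.
Definition bit_body := Rnd vb ;; vkey :<- #vkey + #vkey + #vb.
Definition key_body :=
  vkey :<- $0 ;; For vl vL bit_body ;; Put 1 #vi #vkey.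
Definition key_phase := For vi vn key_body.
Definition win_phase C :=
  vD :<- $C * (#vL + $1) * #vM * #vwm ;; vcnt :<- $8 * #vD.
(* The window is swept downwards, so that cell v - w still refers to the state
   before the current item. *)
Definition cell_body :=
  vv :<- #vst + (#vcnt - ($1 + #vj)) ;;
  Put 2 #vv (emax (Get 2 #vv) (Get 2 (#vv - #vw) + #vp)).
(** The language has no conditional: the sweep length [vc] is [vcnt] if the key equals [vt] and 0
    otherwise, by truncated subtraction. Starting at the maximum of [vlo] and [vw] keeps [v - w]
    from being truncated, so no cell receives a set that is too heavy. *)
Definition item_body :=
  vw :<- in_w ;; vp :<- in_p ;; vkey :<- Get 1 #vi ;;
  vc :<- #vcnt * ($1 - ((#vkey - #vt) + (#vt - #vkey))) ;;
  vst :<- emax #vlo #vw ;;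
  For vj vc cell_body.
Definition bucket_body :=
  vlo :<- #vt * #vW / #vM - $2 * #vD ;; For vi vn item_body.
Definition dp_phase := For vt vM bucket_body.
(** The cells need not be monotone and the weight of the optimal set is unknown, but it is one of
    the [wm] values ending at [W']. *)
Definition ans_phase :=
  vans :<- $0 ;; For vj vwm (vans :<- emax #vans (Get 2 (#vW - #vj))).
Definition prog C :=
  sum_phase ;; log_phase ;; key_phase ;; win_phase C ;; dp_phase ;; ans_phase.

Lemma prog_wf C K : 8 <= K -> C <= K -> cwf K 20 (prog C).
Proof. by move=> h1 h2; rewrite /cwf /= !andbT h2; lia. Qed.

Local Close Scope prog_scope.

Definition bits_val (s : seq bool) : nat := foldl (fun k (b : bool) => k + k + b) 0 s.
(** Item [i] owns the bits from [i * L] to [i * L + L - 1]; independence of the keys comes from the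
    disjointness of these blocks. *)
Definition item_key (r : seq bool) L i := bits_val (mkseq (fun l => nth false r (i * L + l)) L).

Lemma sum_ord_le (F : nat -> nat) k n : k <= n -> \sum_(i < k) F i <= \sum_(i < n) F i.
Proof.
elim: n => [|n IH]; first by rewrite leqn0 => /eqP ->.
rewrite leq_eqVlt => /orP[/eqP-> //|]; rewrite ltnS => /IH h.
by rewrite big_ord_recr /=; apply: leq_trans h (leq_addr _ _).
Qed.

Lemma sum_ord_elem (F : nat -> nat) k n : k < n -> F k <= \sum_(i < n) F i.
Proof.
by move=> h; apply: leq_trans (sum_ord_le F h); rewrite big_ord_recr /= leq_addl.
Qed.

Lemma max_ord_le (F : nat -> nat) n : \max_(i < n) F i <= \sum_(i < n) F i.
Proof.
apply/bigmax_leqP => i _; exact: sum_ord_elem.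
Qed.

Lemma spec_asg V r x e s (Q : store -> Prop) k :
  eval e s <= V -> Q (setr s x (eval e s)) -> csize (Asg x e) <= k -> spec V r (Asg x e) s Q k.
Proof. by []. Qed.

Lemma spec_asg_seq V r x e c s (Q : store -> Prop) k :
  eval e s <= V -> spec V r c (setr s x (eval e s)) Q k ->
  spec V r (Seq (Asg x e) c) s Q (csize (Asg x e) + k).
Proof. by move=> he [o q h]; split=> //=; rewrite leq_add2l. Qed.

Lemma bits_val_lt s : bits_val s < 2 ^ size s.
Proof.
elim/last_ind: s => // s b IH; rewrite /bits_val foldl_rcons size_rcons expnS.
by rewrite -/(bits_val s); case: b; lia.
Qed.

Section BucketCount.
Variable n : nat.
Let L := up_log 4 n.
Let M := 2 ^ L.

(** This is the test of [log_body] at [M = 2 ^ k]; with [L <= n], a loop of [n] conditional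
    doublings ends exactly at [2 ^ L]. *)
Lemma M_sq k : k < L = (2 ^ k * 2 ^ k < n).
Proof.
rewrite -expnMn; apply/idP/idP => h; rewrite ltnNge; apply/negP=> h'.
  by have := @up_log_min 4 _ _ isT h'; rewrite -/L leqNgt h.
by have := @up_logP 4 n isT; rewrite -/L leqNgt (leq_ltn_trans _ h) // leq_exp2l.
Qed.

Lemma L_le : L <= n.
Proof.
by apply: up_log_min => //; apply: ltnW; apply: ltn_expl.
Qed.

Lemma M_ge : n <= M * M.
Proof. by rewrite leqNgt -M_sq ltnn. Qed.

Hypothesis n2 : 1 < n.

Lemma L_gt0 : 0 < L.
Proof. by rewrite M_sq. Qed.

Lemma M_lt : M * M < 4 * n.
Proof.
have := L_gt0; rewrite /M; case EL: L => [|l] // _.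
have : l < L by rewrite EL.
by rewrite M_sq expnS; lia.
Qed.

Lemma M_le : M < 2 * n.
Proof. by have := M_lt; nia. Qed.

End BucketCount.

(** * Correctness and cost of the phases of the program *)

Section Program.
Variables (U V C n W : nat) (r : seq bool) (wv pv : nat -> nat).
Hypothesis n2 : 1 < n.
Hypothesis C1 : 0 < C.
Hypothesis nU : n + n + 2 <= U.
Hypothesis WU : W <= U.
Hypothesis VU : U + 8 * C * (U * U * U) <= V.
Hypothesis wU : \sum_(i < n) wv i <= U.
Hypothesis pU : \sum_(i < n) pv i <= U.

Let sw := \sum_(i < n) wv i.
Let wm := \max_(i < n) wv i.
Let W' := minn W sw.
Let L := up_log 4 n.
Let M := 2 ^ L.
Let D := C * (L + 1) * M * wm.
Let M_lt_2n : M < 2 * n := M_le n2.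
Let L_le_n : L <= n := L_le n.
Let n_le_MM : n <= M * M := M_ge n.

Lemma UV : U <= V. Proof. by apply: leq_trans VU; apply: leq_addr. Qed.

Lemma UUV : U + U <= V.
Proof.
apply: leq_trans VU; rewrite leq_add2l; apply: (@leq_trans (U * U * U)).
  by rewrite -mulnA; apply: leq_pmulr; rewrite muln_gt0; lia.
by apply: leq_pmull; rewrite muln_gt0.
Qed.

Definition input_ok s := forall i, i < n -> ar s 0 (2 + 2 * i) = wv i /\ ar s 0 (3 + 2 * i) = pv i.

Lemma sum_ok s : rg s vn = n -> rg s vW = W -> input_ok s ->
  spec V r sum_phase s
    (fun s1 => [/\ rg s1 vwm = wm, rg s1 vW = W', ar s1 = ar s & us s1 = us s]) (20 + 40 * n).
Proof.
move=> hn hW hin.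
have UV := UV.
have wU' i : i < n -> wv i <= U.
  by move=> hi; apply: leq_trans wU; apply: (sum_ord_elem wv).
have sU k : k <= n -> \sum_(i < k) wv i <= U.
  by move=> hk; apply: leq_trans wU; apply: (sum_ord_le wv).
have mU k : k <= n -> \max_(i < k) wv i <= U.
  by move=> hk; apply: leq_trans (max_ord_le wv k) (sU _ hk).
eapply spec_cost.
- eapply spec_asg_seq => //; eapply spec_asg_seq => //; eapply spec_seq.
    apply: (spec_frame (@spec_for _ _ _ _ _ _ (fun k s1 => [/\ rg s1 vwm = \max_(i < k) wv i, rg s1 vsw = \sum_(i < k) wv i,
         ar s1 = ar s & us s1 = us s]) (fun=> 30) _ _ _)) => //.
      by rewrite !big_ord0.
    rewrite /= /upd /= hn => k s1 hk hi hf [h1 h2 h3 h4].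
    have [e1 e2] := hin k hk.
    have hA : wv k <= U by apply: wU'.
    have hB := sU k.+1 hk; rewrite big_ord_recr /= in hB.
    have hM := mU k.+1 hk; rewrite big_ord_recr /= in hM.
    split=> //=.
      rewrite /upd /= h3 hi e1 h1 h2; split; first exact: leq_trans UV.
      split; first exact: leq_trans UV.
      by apply: leq_trans UV; rewrite -maxnE.
    by rewrite /upd /= h3 hi e1 h1 h2 h4 !big_ord_recr /= -maxnE.
  rewrite /= /upd /= => s1 [[h1 h2 h3 h4] hf]; rewrite hn in h1 h2.
  have eW : rg s1 vW = W by rewrite hf //.
  apply: (@spec_asg _ _ _ _ _ _ 10) => //=; rewrite eW h2.
    by apply: leq_trans UV; apply: leq_trans WU; apply: leq_subr.
  by split=> //; rewrite /upd /= -minnE.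
- rewrite /= /upd /= hn sum_nat_const card_ord; lia.
Qed.

Lemma log_ok s : rg s vn = n ->
  spec V r log_phase s
    (fun s1 => [/\ rg s1 vM = M, rg s1 vL = L, ar s1 = ar s & us s1 = us s]) (20 + 40 * n).
Proof.
move=> hn; have UV := UV.
eapply spec_weak.
- eapply spec_asg_seq; first by rewrite /=; lia.
  eapply spec_asg_seq => //.
  apply: (spec_frame (@spec_for _ _ _ _ _ _ (fun k s1 => [/\ rg s1 vM = 2 ^ minn k L, rg s1 vL = minn k L,
         ar s1 = ar s & us s1 = us s]) (fun=> 35) _ _ _)) => //.
    by rewrite min0n.
  rewrite /= /upd /= hn => k s1 hk hi hf [h1 h2 h3 h4].
  have hn1 : rg s1 vn = n by rewrite hf.
  have hML : 2 ^ minn k L <= M by rewrite leq_exp2l // geq_minr.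
  have := M_sq n (minn k L); have := M_lt_2n; have := L_le_n.
  rewrite -/L -/M => hLn hMn hsq.
  have e1 : 1 - (1 - (n - 2 ^ minn k L * 2 ^ minn k L)) = (minn k L < L).
    by rewrite hsq; move: (2 ^ minn k L * _) => x; clear; lia.
  split=> //=; rewrite /upd /= hn1 h1 ?h2 e1.
  + split; first by case: (_ < _); lia.
    split; last by case: (_ < _); lia.
    case: (boolP (_ < _)) => hb /=; last by rewrite mul0n addn0; lia.
    rewrite mul1n addnn -mul2n -expnS.
    have : 2 ^ (minn k L).+1 <= M by rewrite leq_exp2l.
    lia.
  + split=> //; case: (boolP (_ < _)) => hb /=; rewrite ?addn0 ?mul0n ?addn0.
    * by rewrite mul1n addnn -mul2n -expnS; congr (2 ^ _); lia.
    * by congr (2 ^ _); lia.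
    * by lia.
    * by lia.
- rewrite /= /upd /= hn => s1 [[h1 h2 h3 h4] _].
  by rewrite h1 h2 (minn_idPr L_le_n).
- rewrite /= /upd /= hn sum_nat_const card_ord; lia.
Qed.

Lemma key_ok s : rg s vn = n -> rg s vL = L -> us s = 0 ->
  spec V r key_phase s
    (fun s1 => [/\ forall i, i < n -> ar s1 1 i = item_key r L i,
       ar s1 0 = ar s 0 & ar s1 2 = ar s 2]) (20 + n * (60 + 40 * L)).
Proof.
move=> hn hL hu; have UV := UV.
eapply spec_weak.
- apply: (@spec_for _ _ _ _ _ _ (fun k s1 => [/\ us s1 = k * L, forall i, i < k -> ar s1 1 i = item_key r L i,
       ar s1 0 = ar s 0 & ar s1 2 = ar s 2]) (fun=> 50 + 40 * L)) => //.
  rewrite /= /upd /= hn => k s1 hk hi hf [h1 h2 h3 h4].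
  have hL1 : rg s1 vL = L by rewrite hf.
  eapply spec_cost.
  + eapply spec_asg_seq => //; eapply (@spec_seq _ _ _ _ _ _ _ _ 20).
      apply: (spec_frame (@spec_for _ _ _ _ _ _ (fun l s2 => [/\ us s2 = k * L + l, ar s2 = ar s1 &
         rg s2 vkey = bits_val (mkseq (fun l => nth false r (k * L + l)) l)]) (fun=> 20) _ _ _)) => //.
        by rewrite /= h1 addn0.
      rewrite /= /upd /= hL1 => l s2 hl hl2 hf2 [g1 g2 g3].
      have hB := bits_val_lt (mkseq (fun l => nth false r (k * L + l)) l.+1).
      rewrite size_mkseq mkseqS /bits_val foldl_rcons in hB.
      have hM : 2 ^ l.+1 <= M by rewrite leq_exp2l.
      have hMn := M_lt_2n.
      split=> //=; rewrite /upd /= g3 g1.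
      * by split=> //; rewrite /bits_val; lia.
      * by rewrite g2 mkseqS /bits_val foldl_rcons addnS.
    rewrite /= /upd /= hL1 => s2 [[g1 g2 g3] hf2].
    have hi2 : rg s2 vi = k by rewrite hf2 //= hi.
    have hB := bits_val_lt (mkseq (fun l => nth false r (k * L + l)) L).
    rewrite size_mkseq in hB; have hMn := M_lt_2n.
    split; [|split|by []]; rewrite /= ?g3.
    * by move: hB; rewrite -/M; lia.
    * by rewrite g1 mulSn addnC.
    * move=> i; rewrite ltnS hi2 g2 => hik; case: eqP => [->|hne] //.
      by apply: h2; lia.
    * by rewrite g2.
    * by rewrite g2.
  + by rewrite /= /upd /= hL1 sum_nat_const card_ord; lia.
- by rewrite hn => s1 [_ h1 h2 h3].
- rewrite /= hn sum_nat_const card_ord; nia.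
Qed.

Lemma D_le : D <= C * (U * U * U).
Proof.
rewrite /D -!mulnA leq_mul2l; apply/orP; right; apply: leq_mul.
  by have := L_le_n; lia.
apply: leq_mul; first by have := M_lt_2n; lia.
by apply: leq_trans (max_ord_le wv n) wU.
Qed.

Lemma win_ok s : rg s vL = L -> rg s vM = M -> rg s vwm = wm ->
  spec V r (win_phase C) s
    (fun s1 => [/\ rg s1 vD = D, rg s1 vcnt = 8 * D, ar s1 = ar s & us s1 = us s]) 30.
Proof.
move=> h1 h2 h3; have := D_le => hD.
by split=> //=; rewrite /upd /= h1 h2 h3 -/D; [lia|].
Qed.

Definition cells lo w p (f : nat -> nat) v :=
  let st := maxn lo w in
  if st <= v < st + 8 * D then maxn (f v) (f (v - w) + p) else f v.

Section Buckets.
Variable key : nat -> nat.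
Hypothesis key_lt : forall i, i < n -> key i < M.

Lemma item_ok s t i lo :
  i < n -> 0 < wv i -> rg s vi = i -> rg s vt = t -> rg s vlo = lo -> rg s vcnt = 8 * D ->
  lo <= U -> input_ok s -> ar s 1 i = key i -> (forall v, ar s 2 v <= U) ->
  spec V r item_body s
    (fun s1 => [/\ forall v, ar s1 2 v = if key i == t then cells lo (wv i) (pv i) (ar s 2) v
                                         else ar s 2 v,
        ar s1 0 = ar s 0 & ar s1 1 = ar s 1])
    (100 + (key i == t) * (8 * D * 60)).
Proof.
move=> hi hw0 hvi ht hlo hcnt loU hin hkey hf.
have UV := UV; have hD := D_le.
have [e1 e2] := hin _ hi.
have wiU : wv i <= U by apply: leq_trans wU; apply: (sum_ord_elem wv).
have piU : pv i <= U by apply: leq_trans pU; apply: (sum_ord_elem pv).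
have e3 : 1 - ((key i - t) + (t - key i)) = (key i == t) by lia.
have kU : key i <= U by have := key_lt hi; have := M_lt_2n; lia.
pose st := maxn lo (wv i).
have stU : st <= U by rewrite geq_max loU.
(* After [j] steps of the downward sweep the top [j] cells of the window are updated; the next step
   reads its own cell and a cell [wv i] lower, both still old. *)
pose fj j v := if st + (8 * D - j) <= v < st + 8 * D
               then maxn (ar s 2 v) (ar s 2 (v - wv i) + pv i) else ar s 2 v.
eapply spec_weak.
- eapply spec_asg_seq; first by rewrite /= /upd /= hvi e1; lia.
  eapply spec_asg_seq; first by rewrite /= /upd /= hvi e2; lia.
  eapply spec_asg_seq; first by rewrite /= /upd /= hvi hkey; lia.
  eapply spec_asg_seq.
    by rewrite /= /upd /= hvi hkey hcnt ht e3; case: (key i == t); lia.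
  eapply spec_asg_seq.
    by rewrite /= /upd /= hlo hvi e1 -maxnE -/st; lia.
  apply: (@spec_for _ _ _ _ _ _ (fun j s1 => [/\ forall v, ar s1 2 v = fj j v,
     ar s1 0 = ar s 0 & ar s1 1 = ar s 1]) (fun=> 55)) => //.
    split=> // v; rewrite /fj subn0; case: ifP => //= /andP[h1 h2]; lia.
  rewrite /= /upd /= hvi hkey hcnt ht e3 hlo e1 e2 -maxnE -/st => j s1 hj hj1 hf1 [h1 h2 h3].
  have [ekt jD] : key i = t /\ j < 8 * D.
    by move: hj; case: eqP => [->|]; rewrite ?muln1 ?muln0.
  have g1 : rg s1 vst = st by rewrite hf1.
  have g2 : rg s1 vcnt = 8 * D by rewrite hf1 //= /upd /= hcnt.
  have g3 : rg s1 vw = wv i by rewrite hf1.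
  have g4 : rg s1 vp = pv i by rewrite hf1.
  have hst : wv i <= st by rewrite leq_maxr.
  split=> //=; rewrite /upd /= g1 g2 hj1 ?g3 ?g4 ?h1 -?maxnE.
  + set v0 := st + (8 * D - (1 + j)).
    have -> : fj j v0 = ar s 2 v0 by rewrite /fj; case: ifP => // /andP[]; lia.
    have -> : fj j (v0 - wv i) = ar s 2 (v0 - wv i) by rewrite /fj; case: ifP => // /andP[]; lia.
    have := hf v0; have := hf (v0 - wv i) => hfa hfb.
    split; first by lia.
    by have := UUV; rewrite geq_max; lia.
  + set v0 := st + (8 * D - (1 + j)).
    have -> : fj j v0 = ar s 2 v0 by rewrite /fj; case: ifP => // /andP[]; lia.
    have -> : fj j (v0 - wv i) = ar s 2 (v0 - wv i) by rewrite /fj; case: ifP => // /andP[]; lia.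
    split=> // v; rewrite h1.
    case: (v =P v0) => [->|hv].
      by rewrite /fj ifT //; lia.
    by rewrite /fj; congr (if _ then _ else _); lia.
- rewrite /= /upd /= hvi hkey hcnt ht e3 => s1 [h1 h2 h3]; split=> // v.
  rewrite h1 /fj /cells -/st; case: (key i == t); rewrite ?muln1 ?muln0 ?subnn ?subn0 ?addn0 //.
  by case: ifP => // /andP[]; lia.
- rewrite /= /upd /= hvi hkey hcnt ht e3 sum_nat_const card_ord; case: (key i == t); lia.
Qed.

Section Invariant.
Variable I : nat -> nat -> (nat -> nat) -> Prop.
Let lo t := t * W' %/ M - 2 * D.
Hypothesis I_bound : forall t i f, I t i f -> forall v, f v <= U.
Hypothesis I_item : forall t i f g, t < M -> i < n -> I t i f ->
  (forall v, g v = if key i == t then cells (lo t) (wv i) (pv i) f v else f v) -> I t i.+1 g.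
Hypothesis I_bucket : forall t f, I t n f -> I t.+1 0 f.
Hypothesis w_gt0 : forall i, i < n -> 0 < wv i.

Lemma lo_le t : t < M -> lo t <= U.
Proof.
move=> ht; apply: leq_trans (leq_subr _ _) _; apply: leq_trans (leq_trans (geq_minl W sw) WU).
have M0 : 0 < M by lia.
have h : t * W' <= M * W' by rewrite leq_mul2r (ltnW ht) orbT.
apply: leq_trans (leq_div2r M h) _; by rewrite mulKn.
Qed.

(** The abstract invariant [I] separates the execution of the nested loops from the combinatorics of
    the dynamic program. *)
Lemma dp_ok s : rg s vn = n -> rg s vW = W' -> rg s vM = M -> rg s vD = D ->
  rg s vcnt = 8 * D -> input_ok s -> (forall i, i < n -> ar s 1 i = key i) -> I 0 0 (ar s 2) ->
  spec V r dp_phase s (fun s1 => I M 0 (ar s1 2)) (20 + M * (60 + 110 * n) + n * (8 * D * 60)).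
Proof.
move=> hn hW hM hD hcnt hin hkey hI; have UV := UV; have hDl := D_le.
eapply spec_weak.
- apply: (@spec_for _ _ _ _ _ _ (fun t s1 => [/\ I t 0 (ar s1 2), ar s1 0 = ar s 0 & ar s1 1 = ar s 1])
    (fun t => 50 + \sum_(i < n) (3 + (100 + (key i == t) * (8 * D * 60))))) => //.
  rewrite /= /upd /= hM => t s1 ht ht1 hf1 [h1 h2 h3].
  have g1 : rg s1 vn = n by rewrite hf1.
  have g2 : rg s1 vW = W' by rewrite hf1.
  have g3 : rg s1 vM = M by rewrite hf1.
  have g4 : rg s1 vD = D by rewrite hf1.
  have g5 : rg s1 vcnt = 8 * D by rewrite hf1.
  have hlo := lo_le ht.
  eapply spec_weak.
  + eapply spec_asg_seq; first by rewrite /= ht1 g2 g3 g4; apply: leq_trans hlo UV.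
    rewrite /= ht1 g2 g3 g4.
    apply: (@spec_for _ _ _ _ _ _ (fun i s2 => [/\ I t i (ar s2 2), ar s2 0 = ar s 0 & ar s2 1 = ar s 1])
       (fun i => 100 + (key i == t) * (8 * D * 60))) => //.
    rewrite /= /upd /= g1 => i s2 hi hi2 hf2 [k1 k2 k3].
    have gin : input_ok s2 by move=> j hj; rewrite k2; apply: hin.
    eapply spec_weak.
    * apply: (@item_ok s2 t i (lo t)) => //; rewrite ?hf2 ?k3 //=; [exact: w_gt0|exact: hkey|].
      exact: I_bound k1.
    * move=> s3 [q1 q2 q3]; split; rewrite /= ?q2 ?q3 //; exact: I_item k1 q1.
    * by [].
  + rewrite /= /upd /= g1 => s2 [k1 k2 k3]; split=> //=; exact: I_bucket.
  + rewrite /= /upd /= g1; lia.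
- by rewrite hM => s1 [].
- rewrite hM.
  rewrite (eq_bigr (fun t : 'I_M => (53 + 103 * n) + \sum_(i < n) (key i == t) * (8 * D * 60))); last first.
    by move=> t _; rewrite !big_split /= !sum_nat_const !card_ord; lia.
  rewrite big_split /= sum_nat_const card_ord exchange_big /=.
  (* Each item pays for a sweep in one bucket only, that of its key. *)
  have : \sum_(i < n) \sum_(t < M) (key i == t) * (8 * D * 60) <= \sum_(i < n) (8 * D * 60).
    apply: leq_sum => i _; rewrite -big_distrl /= -[leqRHS]mul1n leq_mul2r; apply/orP; right.
    rewrite (bigD1 (Ordinal (key_lt (ltn_ord i)))) //= eqxx big1 // => t.
    by rewrite -val_eqE /= eq_sym => /negbTE ->.
  rewrite sum_nat_const card_ord.
  have : M * (53 + 103 * n) <= M * (60 + 110 * n) by apply: leq_mul => //; lia.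
  move=> h1 h2; rewrite -addnA; exact: leq_add (leq_add h1 h2).
Qed.
End Invariant.
End Buckets.

Lemma ans_ok s : rg s vW = W' -> rg s vwm = wm -> (forall v, ar s 2 v <= U) ->
  spec V r ans_phase s (fun s1 => rg s1 vans = \max_(j < wm) ar s 2 (W' - j)) (20 + wm * 30).
Proof.
move=> hW hm hf; have UV := UV.
eapply spec_weak.
- eapply spec_asg_seq => //.
  apply: (@spec_for _ _ _ _ _ _ (fun k s1 => rg s1 vans = \max_(j < k) ar s 2 (W' - j) /\ ar s1 = ar s)
     (fun => 25)) => //.
    by rewrite big_ord0.
  rewrite /= /upd /= hm => k s1 hk hk1 hf1 [h1 h2].
  have g1 : rg s1 vW = W' by rewrite hf1.
  have mU : \max_(j < k) ar s 2 (W' - j) <= U by apply/bigmax_leqP => j _; apply: hf.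
  split=> //=; rewrite /upd /= hk1 g1 h1 h2 -maxnE ?big_ord_recr //=.
  by apply: leq_trans UV; rewrite geq_max mU hf.
- by rewrite /= /upd /= hm => s1 [].
- by rewrite /= /upd /= hm sum_nat_const card_ord; lia.
Qed.

(** * Balanced keys make the windowed dynamic program exact *)

Section Correct.
Variable key : nat -> nat.
Hypothesis key_lt : forall i, i < n -> key i < M.
Hypothesis w_gt0 : forall i, i < n -> 0 < wv i.
Variable S : {set 'I_n}.
Let ws := \sum_(x in S) wv x.
Hypothesis ws_le : ws <= W'.
Hypothesis ws_gt : W' < ws + wm.

Definition prefix_weight t := \sum_(x in S | key x < t) wv x.
Hypothesis key_balanced : forall t, t <= M ->
  M * prefix_weight t <= t * ws + M * D /\ t * ws <= M * prefix_weight t + M * D.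

Definition done t i := [set x : 'I_n | (key x < t) || ((key x == t) && (x < i))].

(** Soundness concerns every cell, completeness only the one cell at the current partial weight of
    [S]; cells outside the windows may be stale. *)
Definition dp_inv t i (f : nat -> nat) :=
  (forall v, exists T : {set 'I_n}, [/\ T \subset done t i, \sum_(x in T) wv x <= v &
                                       \sum_(x in T) pv x = f v]) /\
  \sum_(x in S :&: done t i) pv x <= f (\sum_(x in S :&: done t i) wv x).

Lemma done_step t (i : 'I_n) : key i = t -> done t i.+1 = i |: done t i.
Proof.
move=> hk; apply/setP => x; rewrite !inE ltnS (leq_eqVlt x i) -[nat_of_ord x == i]/(x == i).
by case: (x =P i) => [->|_] //=; rewrite hk eqxx orbT.
Qed.

Lemma done_same t (i : 'I_n) : key i != t -> done t i.+1 = done t i.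
Proof.
move=> hk; apply/setP => x; rewrite !inE ltnS (leq_eqVlt x i) -[nat_of_ord x == i]/(x == i).
by case: (x =P i) => [->|_] //=; rewrite (negbTE hk).
Qed.

Lemma done_notin t (i : 'I_n) : key i = t -> i \notin done t i.
Proof. by move=> hk; rewrite !inE hk ltnn eqxx ltnn. Qed.

Lemma wm_gt0 : 0 < wm.
Proof.
have n0 : 0 < n by lia.
by apply: leq_trans (w_gt0 n0) _; rewrite /wm (bigD1 (Ordinal n0)) //= leq_maxl.
Qed.

Lemma MwmD : M * wm <= D.
Proof.
rewrite /D leq_mul2r; apply/orP; right; apply: leq_pmull; rewrite muln_gt0 C1; lia.
Qed.

Lemma M_gt0 : 0 < M. Proof. by rewrite expn_gt0. Qed.

Lemma W_le_MD : W' <= M * D.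
Proof.
apply: (@leq_trans (n * wm)).
  apply: leq_trans (geq_minr _ _) _; rewrite /sw -[n in leqRHS]card_ord -sum_nat_const.
  by apply: leq_sum => i _; rewrite /wm (bigD1 i) //= leq_maxl.
apply: (@leq_trans (M * M * wm)); first by rewrite leq_mul2r n_le_MM orbT.
by rewrite -mulnA leq_mul2l MwmD orbT.
Qed.

(** The partial weight [z] lies between the prefix weights at [t] and [t.+1], hence within [2 * D]
    of the centre [q]. This needs a length just above [4 * D], so [8 * D] is ample. *)
Lemma window (i : 'I_n) t : i \in S -> key i = t ->
  let z := \sum_(x in S :&: done t i.+1) wv x in
  let lo := t * W' %/ M - 2 * D in
  maxn lo (wv i) <= z < maxn lo (wv i) + 8 * D.
Proof.
move=> iS hk /=; set z := \sum_(_ in _) _; set lo := _ - _.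
have tM : t < M by rewrite -hk key_lt.
have wz : wv i <= z.
  by rewrite /z (bigD1 i) ?leq_addr // inE iS done_step // !inE eqxx.
have zlo : prefix_weight t <= z.
  rewrite /z /prefix_weight [leqRHS]big_mkcond [leqLHS]big_mkcond /=.
  by apply: leq_sum => x _; rewrite !inE; case: (x \in S) => //=; case: (key x < t).
have zhi : z <= prefix_weight t.+1.
  rewrite /z /prefix_weight [leqRHS]big_mkcond [leqLHS]big_mkcond /=.
  apply: leq_sum => x _; rewrite !inE (ltnS (key x) t) (leq_eqVlt (key x) t); case: (x \in S) => //=.
  by case: (key x == t); case: (key x < t) => //=; case: (x < i.+1).
have [_ b1] := key_balanced (ltnW tM); have [b2 _] := key_balanced tM.
have hW := W_le_MD; have hD := MwmD; have M0 := M_gt0; have wm0 := wm_gt0.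
have wmD : wm <= D by apply: leq_trans hD; apply: leq_pmull.
have D0 : 0 < D by apply: leq_trans wmD.
have e := divn_eq (t * W') M; have hr := ltn_pmod (t * W') M0.
rewrite /lo; move: (t * W' %/ M) (t * W' %% M) e hr => q rr e hr.
(* One [D] pays for the deviation, the other for replacing [ws] by [W'], which costs less than
   [wm]. *)
have h1 : q <= z + 2 * D.
  have : M * q <= M * (z + 2 * D).
    have : t * W' <= t * (ws + wm) by rewrite leq_mul2l (ltnW ws_gt) orbT.
    have : t * wm <= M * D by apply: leq_mul => //; apply: ltnW.
    have : M * prefix_weight t <= M * z by rewrite leq_mul2l zlo orbT.
    rewrite !mulnDr; move: b1 e; clear; lia.
  by rewrite leq_mul2l; lia.
(* One [D] pays for the deviation, the other for the drift [W' / M] across the bucket, by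
   [W_le_MD]. *)
have h2 : z <= q + 2 * D.
  have : M * z < M * (q + 2 * D).+1.
    have : M * z <= M * prefix_weight t.+1 by rewrite leq_mul2l zhi orbT.
    have : t.+1 * ws <= t.+1 * W' by rewrite leq_mul2l ws_le orbT.
    rewrite [t.+1 * W']mulSn; move: b2 e hr hW; clear; rewrite [M * (q + 2 * D).+1]mulnS; lia.
  by rewrite ltn_mul2l; lia.
by rewrite geq_max wz andbT; apply/andP; split; [lia|have := leq_maxl (q - 2 * D) (wv i); lia].
Qed.

Lemma dp_inv_bound t i f : dp_inv t i f -> forall v, f v <= U.
Proof.
case=> h _ v; have [T [_ _ <-]] := h v; apply: leq_trans pU.
by rewrite [leqRHS](bigID (mem T)) /= leq_addr.
Qed.

(** An update never lowers a cell, which settles items outside [S]; for an item of [S], [window]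
    ensures that the update reaches the tracked cell. *)
Lemma dp_inv_item t i f g : t < M -> i < n -> dp_inv t i f ->
  (forall v, g v = if key i == t then cells (t * W' %/ M - 2 * D) (wv i) (pv i) f v else f v) ->
  dp_inv t i.+1 g.
Proof.
move=> ht hi; pose x : 'I_n := Ordinal hi; rewrite -[i]/(nat_of_ord x) => -[hs hc] hg.
case: (boolP (key x == t)) hg => [/eqP hk|hk] hg; last first.
  by rewrite /dp_inv done_same //; split=> [v|]; rewrite hg.
have xn := done_notin hk; rewrite /dp_inv; split=> [v|].
  rewrite hg /cells done_step //; set lo := _ - _.
  have keep : exists T : {set 'I_n}, [/\ T \subset x |: done t x, \sum_(y in T) wv y <= v &
                                       \sum_(y in T) pv y = f v].
    have [T [h1 h2 h3]] := hs v; exists T; split=> //.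
    by apply: subset_trans h1 (subsetUr _ _).
  case: ifP => [/andP[hv _]|] //; case: (leqP (f (v - wv x) + pv x) (f v)) => _ //.
  have [T [h1 h2 h3]] := hs (v - wv x).
  have xT : x \notin T by apply/negP => /(subsetP h1); rewrite (negbTE xn).
  exists (x |: T); split; first exact: setUS.
  - rewrite big_setU1 //=; move: hv; rewrite geq_max => /andP[_ hv].
    by rewrite -(subnKC hv) leq_add2l.
  - by rewrite big_setU1 //= h3 addnC.
have mono v : f v <= g v.
  by rewrite hg /cells; case: ifP => // _; rewrite leq_maxl.
case: (boolP (x \in S)) => xS; last first.
  have -> : S :&: done t x.+1 = S :&: done t x.
    apply/setP => y; rewrite done_step // !inE; case: (y =P x) => [->|//].
    by rewrite (negbTE xS).
  exact: leq_trans hc (mono _).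
have := window xS hk; rewrite /=; set z := \sum_(_ in _) _ => hz.
rewrite hg /cells hz.
have eS : S :&: done t x.+1 = x |: (S :&: done t x).
  by rewrite done_step // setIUr; congr (_ :|: _); apply/setIidPr; rewrite sub1set.
have xn' : x \notin S :&: done t x by rewrite inE negb_and xn orbT.
have -> : z - wv x = \sum_(y in S :&: done t x) wv y by rewrite /z eS big_setU1 //= addKn.
by rewrite eS big_setU1 //= leq_max addnC leq_add2r hc orbT.
Qed.

Lemma dp_inv_bucket t f : dp_inv t n f -> dp_inv t.+1 0 f.
Proof.
rewrite /dp_inv; suff -> : done t.+1 0 = done t n by [].
by apply/setP => x; rewrite !inE ltn_ord ltn0 andbF orbF andbT (ltnS (key x) t) (leq_eqVlt (key x) t) orbC.
Qed.

Lemma dp_inv0 f : (forall v, f v = 0) -> dp_inv 0 0 f.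
Proof.
have d0 : done 0 0 = set0 by apply/setP => x; rewrite !inE !ltn0 andbF.
move=> hf; split=> [v|]; last by rewrite d0 setI0 !big_set0.
by exists set0; rewrite !big_set0 hf sub0set.
Qed.

Lemma dp_inv_answer f : dp_inv M 0 f ->
  \sum_(x in S) pv x = \max_(T : {set 'I_n} | \sum_(x in T) wv x <= W) \sum_(x in T) pv x ->
  \max_(j < wm) f (W' - j) = \sum_(x in S) pv x.
Proof.
case=> hs hc hS; apply/eqP; rewrite eqn_leq; apply/andP; split.
  apply/bigmax_leqP => j _; have [T [_ h2 <-]] := hs (W' - j); rewrite hS.
  rewrite (bigD1 T) /=; first exact: leq_maxl.
  by apply: leq_trans h2 _; apply: leq_trans (leq_subr _ _) (geq_minl _ _).
have dT : S :&: done M 0 = S.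
  by apply/setIidPl/subsetP => x _; rewrite inE key_lt.
rewrite dT -/ws in hc; apply: leq_trans hc _.
have hj : W' - ws < wm by lia.
have -> : ws = W' - Ordinal hj by rewrite /= subKn.
by rewrite (bigD1 (Ordinal hj)) //= leq_maxl.
Qed.
End Correct.

Definition balanced (S : {set 'I_n}) (key : nat -> nat) :=
  [forall t : 'I_M.+1,
    (M * prefix_weight key S t <= t * \sum_(x in S) wv x + M * D) &&
    (t * \sum_(x in S) wv x <= M * prefix_weight key S t + M * D)].

Lemma item_key_lt i : item_key r L i < M.
Proof. by have := bits_val_lt (mkseq (fun l => nth false r (i * L + l)) L); rewrite size_mkseq. Qed.

Lemma prog_ok (S : {set 'I_n}) s :
  (forall i, i < n -> 0 < wv i) ->
  \sum_(x in S) wv x <= W' -> W' < \sum_(x in S) wv x + wm ->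
  \sum_(x in S) pv x = \max_(T : {set 'I_n} | \sum_(x in T) wv x <= W) \sum_(x in T) pv x ->
  balanced S (item_key r L) ->
  rg s vn = n -> rg s vW = W -> us s = 0 -> input_ok s -> (forall v, ar s 2 v = 0) ->
  spec V r (prog C) s (fun s1 => rg s1 vans = \sum_(x in S) pv x)
    (20 + 40 * n + (20 + 40 * n + (20 + n * (60 + 40 * L) + (30 +
       (20 + M * (60 + 110 * n) + n * (8 * D * 60) + (20 + wm * 30)))))).
Proof.
move=> w0 hS1 hS2 hS3 /forallP hb hn hW hu hin h0.
have hb' t : t <= M -> M * prefix_weight (item_key r L) S t <= t * \sum_(x in S) wv x + M * D
    /\ t * \sum_(x in S) wv x <= M * prefix_weight (item_key r L) S t + M * D.
  by move=> ht; have /andP[] := hb (Ordinal (ht : t < M.+1)).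
have kl i : i < n -> item_key r L i < M by move=> _; exact: item_key_lt.
apply: spec_seq; first exact: (spec_frame (sum_ok hn hW hin)).
move=> s1 [[a1 a2 a3 a4] a5].
have n1 : rg s1 vn = n by rewrite a5.
apply: spec_seq; first exact: (spec_frame (log_ok n1)).
move=> s2 [[b1 b2 b3 b4] b5].
have n2' : rg s2 vn = n by rewrite b5.
have u2 : us s2 = 0 by rewrite b4 a4.
apply: spec_seq; first exact: (spec_frame (key_ok n2' b2 u2)).
move=> s3 [[c1 c2 c3] c4].
have L3 : rg s3 vL = L by rewrite c4.
have M3 : rg s3 vM = M by rewrite c4.
have wm3 : rg s3 vwm = wm by rewrite c4 // b5.
apply: spec_seq; first exact: (spec_frame (win_ok L3 M3 wm3)).
move=> s4 [[d1 d2 d3 d4] d5].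
have n4 : rg s4 vn = n by rewrite d5 // c4.
have W4 : rg s4 vW = W' by rewrite d5 // c4 // b5.
have M4 : rg s4 vM = M by rewrite d5.
have in4 : input_ok s4 by move=> i hi; rewrite d3 c2 b3 a3; exact: hin.
have k4 i : i < n -> ar s4 1 i = item_key r L i by move=> hi; rewrite d3 c1.
have I4 : dp_inv (item_key r L) S 0 0 (ar s4 2).
  by apply: dp_inv0 => v; rewrite d3 c3 b3 a3.
have dp := dp_ok kl (@dp_inv_bound _ S) (dp_inv_item kl w0 hS1 hS2 hb') (@dp_inv_bucket _ S) w0
   n4 W4 M4 d1 d2 in4 k4 I4.
apply: spec_seq; first exact: (spec_frame dp).
move=> s5 [e1 e2].
have W5 : rg s5 vW = W' by rewrite e2.
have wm5 : rg s5 vwm = wm by rewrite e2 // d5.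
apply: spec_weak (ans_ok W5 wm5 (dp_inv_bound e1)) _ (leqnn _) => s6 ->.
by apply: dp_inv_answer e1 hS3.
Qed.

End Program.

(** * Concentration of the bucket weights *)

Section BitSums.
Import GRing.Theory.
Local Open Scope ring_scope.
Variable R : comNzRingType.

(** In this recursive form, cutting the random string in two turns a sum over strings into a nested
    sum. *)
Fixpoint bit_sum T (F : seq bool -> R) : R :=
  if T is T'.+1 then bit_sum T' (fun s => F (true :: s)) + bit_sum T' (fun s => F (false :: s))
  else F [::].

Lemma bit_sumE T (F : seq bool -> R) : \sum_(r : T.-tuple bool) F r = bit_sum T F.
Proof.
elim: T F => [|T IH] F /=.
  by rewrite (big_pred1 [tuple]) // => t; apply/esym/eqP; apply: tuple0.
rewrite -!IH (reindex (fun bt : bool * T.-tuple bool => [tuple of bt.1 :: bt.2])) /=.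
  rewrite -(pair_bigA _ (fun b (t : T.-tuple bool) => F (b :: t))) /=.
  by rewrite big_bool.
exists (fun t => (thead t, [tuple of behead t])) => [[b t]|t] _ /=.
  by congr pair; apply: val_inj.
by rewrite -tuple_eta.
Qed.

Lemma eq_bit_sum T (F G : seq bool -> R) :
  (forall s, size s = T -> F s = G s) -> bit_sum T F = bit_sum T G.
Proof.
elim: T F G => [|T IH] F G h /=; first exact: h.
by congr (_ + _); apply: IH => s hs; apply: h; rewrite /= hs.
Qed.

Lemma bit_sum_cat a b (F : seq bool -> R) :
  bit_sum (a + b) F = bit_sum a (fun s => bit_sum b (fun t => F (s ++ t))).
Proof. by elim: a F => [|a IH] F //=; rewrite !IH. Qed.

Lemma bit_sum_mulr T (F : seq bool -> R) x : bit_sum T (fun s => F s * x) = bit_sum T F * x.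
Proof. by elim: T F => [|T IH] F //=; rewrite !IH mulrDl. Qed.

Lemma bit_sum_mull T (F : seq bool -> R) x : bit_sum T (fun s => x * F s) = x * bit_sum T F.
Proof. by elim: T F => [|T IH] F //=; rewrite !IH mulrDr. Qed.

Lemma bit_sum1 T : bit_sum T (fun=> 1) = 2 ^+ T.
Proof. by elim: T => [|T IH] //=; rewrite !IH exprS mulrDl mul1r. Qed.

Lemma bit_sum_val L (h : nat -> R) :
  bit_sum L (fun s => h (bits_val s)) = \sum_(a < (2 ^ L)%N) h a.
Proof.
(* The accumulator is generalised: the bits read so far fix the leading part of the value. *)
suff gen k : bit_sum L (fun s => h (foldl (fun k (b : bool) => k + k + b)%N k s))
           = \sum_(a < (2 ^ L)%N) h (k * 2 ^ L + a)%N.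
  by rewrite gen; apply: eq_bigr => a _; rewrite mul0n.
elim: L k => [|L IH] k /=; first by rewrite big_ord1 muln1 addn0.
rewrite !IH addrC expnS mul2n -addnn big_split_ord /=; congr (_ + _).
  by apply: eq_bigr => a _; congr h; rewrite addn0; lia.
by apply: eq_bigr => a _; congr h; lia.
Qed.

Lemma item_key0 s t L : size s = L -> item_key (s ++ t) L 0 = bits_val s.
Proof.
move=> hs; rewrite /item_key; congr bits_val; apply: (@eq_from_nth _ false).
  by rewrite size_mkseq hs.
by move=> i; rewrite size_mkseq => hi; rewrite nth_mkseq // mul0n add0n nth_cat hs hi.
Qed.

Lemma item_keyS s t L i : size s = L -> item_key (s ++ t) L i.+1 = item_key t L i.
Proof.
move=> hs; rewrite /item_key; congr bits_val; apply: eq_mkseq => l.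
by rewrite nth_cat hs mulSn -addnA ltnNge leq_addr /= addKn.
Qed.

(** Independence and uniformity of the keys in counting form; the [T - n * L] leftover bits
    contribute the power of 2. *)
Lemma sum_prod_keys n L T (h : nat -> nat -> R) : (n * L <= T)%N ->
  \sum_(r : T.-tuple bool) \prod_(i < n) h i (item_key r L i) =
  2 ^+ (T - n * L) * \prod_(i < n) \sum_(a < (2 ^ L)%N) h i a.
Proof.
rewrite (bit_sumE _ (fun r => \prod_(i < n) h i (item_key r L i))).
elim: n T h => [|n IH] T h hT.
  rewrite big_ord0 mulr1 subn0 -bit_sum1; apply: eq_bit_sum => s _; exact: big_ord0.
rewrite mulSn in hT.
have -> : T = (L + (T - L))%N by lia.
rewrite bit_sum_cat big_ord_recl /=.
transitivity (bit_sum L (fun s => h 0%N (bits_val s) *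
   bit_sum (T - L) (fun t => \prod_(i < n) h i.+1 (item_key t L i)))).
  apply: eq_bit_sum => s hs; rewrite -bit_sum_mull; apply: eq_bit_sum => t _.
  rewrite big_ord_recl /= item_key0 //; congr (_ * _).
  by apply: eq_bigr => i _; rewrite item_keyS.
rewrite bit_sum_mulr bit_sum_val (IH _ (fun i => h i.+1)); last lia.
rewrite mulrCA; congr (2 ^+ _ * _); lia.
Qed.
End BitSums.

(** * A lower bound for products of factors [1 + y_i] *)

Section Tail.
Import Order.TTheory GRing.Theory Num.Theory.
Local Open Scope ring_scope.
Variable R : realFieldType.

Lemma bernoulli_ge (x : R) k : 0 <= x -> 1 + x *+ k <= (1 + x) ^+ k.
Proof.
move=> hx; elim: k => [|k IH]; first by rewrite mulr0n addr0 expr0.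
rewrite exprS; apply: le_trans (ler_wpM2l _ IH); last by lra.
have : 0 <= x * (x *+ k) by apply: mulr_ge0 => //; apply: mulrn_wge0.
by rewrite mulrS; move: (x *+ k) => y; lra.
Qed.

(** With [q = n %/ a], the power contains [a] blocks of [q] factors. Bernoulli's inequality makes
    each block at least [1 + q a / n >= 3/2], as [2 q a >= n]; and two blocks give [9/4 >= 2]. *)
Lemma exp_lower (n a m : nat) : (0 < n)%N -> (a <= n)%N -> (2 * m <= a)%N ->
  2 ^+ m <= (1 + a%:R / n%:R) ^+ n :> R.
Proof.
move=> n0 an ma; have [->|a0] := posnP m.
  rewrite expr0; apply: exprn_ege1; rewrite lerDl; apply: divr_ge0; exact: ler0n.
have {}a0 : (0 < a)%N by lia.
set b := a%:R / n%:R; have b0 : 0 <= b by apply: divr_ge0; exact: ler0n.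
have b1 : 1 <= 1 + b by rewrite lerDl.
pose q := (n %/ a)%N.
have eq := divn_eq n a; have hr := ltn_pmod n a0; rewrite -/q in eq.
have q0 : (0 < q)%N by rewrite divn_gt0.
apply: (@le_trans _ _ ((1 + b) ^+ (q * a))); last first.
  by apply: ler_weXn2l => //; lia.
rewrite exprM; apply: (@le_trans _ _ ((3 / 2) ^+ a)); last first.
  apply: lerXn2r; rewrite ?nnegrE ?exprn_ge0 //; [lra|lra|].
  apply: le_trans (bernoulli_ge _ b0).
  have : n%:R <= (2 * (q * a))%:R :> R by rewrite ler_nat; nia.
  move=> h.
  have n0' : 0 < n%:R :> R by rewrite ltr0n.
  have e : b *+ q = (q * a)%:R / n%:R by rewrite -mulr_natr natrM /b; ring.
  have : 1 / 2 <= (q * a)%:R / n%:R :> R by rewrite ler_pdivlMr //; move: h; rewrite natrM; lra.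
  rewrite e; lra.
apply: (@le_trans _ _ ((3 / 2) ^+ (2 * m))); last by apply: ler_weXn2l => //; lra.
rewrite exprM; apply: lerXn2r; rewrite ?nnegrE ?exprn_ge0 //; lra.
Qed.

(* (1 + y) (1 - y + 2 y^2) >= 1 for y >= -1/2, so the product below is at least
   the inverse of a product that AM-GM bounds from above. *)
Lemma prod_lower (n a m : nat) (y : 'I_n -> R) :
  (0 < n)%N -> (2 * m <= a)%N ->
  (forall i, - (1 / 2) <= y i) -> \sum_i (y i ^+ 2) <= 1 -> a%:R + 2 <= \sum_i y i ->
  2 ^+ m <= \prod_i (1 + y i).
Proof.
move=> n0 ma hy hy2 hs.
pose z i := 1 - y i + 2 * y i ^+ 2.
have z0 i : 0 < z i.
  by rewrite /z; have := sqr_ge0 (y i - 1 / 4); rewrite expr2 => ?; rewrite expr2; lra.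
have hyz i : 1 <= (1 + y i) * z i.
  have := hy i; have := sqr_ge0 (y i); rewrite /z !expr2 => h1 h2.
  have : 0 <= y i * y i * (1 + 2 * y i) by apply: mulr_ge0 => //; lra.
  lra.
have hPz : 0 < \prod_i z i by apply: prodr_gt0.
have hPyz : 1 <= (\prod_i (1 + y i)) * \prod_i z i.
  by rewrite -big_split /=; apply: (big_ind (fun x => 1 <= x)) => // u v; exact: mulr_ege1.
have n0' : 0 < n%:R :> R by rewrite ltr0n.
have hAGM : \prod_i z i <= (1 - a%:R / n%:R) ^+ n.
  have [h _] := @leif_AGM R _ 'I_n z (fun i _ => ltW (z0 i)).
  rewrite card_ord in h; apply: le_trans h _.
  (* The surplus 2 in [a + 2 <= \sum y_i] is spent here, on the term [2 \sum y_i^2 <= 2]. *)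
  have hsz : \sum_i z i <= n%:R - a%:R.
    rewrite /z !big_split /= sumrN -mulr_sumr sumr_const card_ord; lra.
  have hz0 : 0 <= \sum_i z i by apply: sumr_ge0 => i _; apply: ltW.
  have hd : (\sum_i z i) / n%:R <= 1 - a%:R / n%:R.
    by rewrite ler_pdivrMr // mulrBl divfK ?gt_eqF // mul1r.
  have hd0 : 0 <= (\sum_i z i) / n%:R by apply: divr_ge0 => //; apply: ltW.
  apply: lerXn2r => //; rewrite nnegrE //; exact: le_trans hd.
have hmean : 0 <= 1 - a%:R / n%:R :> R.
  have : 0 <= \sum_i z i by apply: sumr_ge0 => i _; apply: ltW.
  have : \sum_i z i <= n%:R - a%:R.
    rewrite /z !big_split /= sumrN -mulr_sumr sumr_const card_ord; lra.
  move=> h1 h2; rewrite subr_ge0 ler_pdivrMr // mul1r; lra.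
(* The bound required by [exp_lower] comes for free: the mean of the positive [z i] is at most
   [1 - a / n]. *)
have an : (a <= n)%N.
  by move: hmean; rewrite subr_ge0 ler_pdivrMr // mul1r ler_nat.
apply: le_trans (exp_lower n0 an ma) _.
set b : R := a%:R / n%:R in hAGM hmean *.
have b0 : 0 <= b by apply: divr_ge0; exact: ler0n.
have hbb : (1 + b) ^+ n * (1 - b) ^+ n <= 1.
  rewrite -exprMn; apply: exprn_ile1; first by apply: mulr_ge0; lra.
  have := sqr_ge0 b; rewrite expr2; lra.
have hB : 0 <= (1 + b) ^+ n by apply: exprn_ge0; lra.
have h1 : (1 + b) ^+ n * \prod_i z i <= (\prod_i (1 + y i)) * \prod_i z i.
  apply: le_trans hPyz; apply: le_trans hbb; exact: ler_wpM2l.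
by rewrite ler_pM2r in h1.
Qed.
End Tail.

(** * Deviation of one prefix weight, in one direction *)

Section Deviation.
Import Order.TTheory GRing.Theory Num.Theory.
Local Open Scope ring_scope.
Variables (n L T A m wm t : nat) (u : nat -> nat).
Local Notation M := (2 ^ L)%N.
Hypothesis n0 : (0 < n)%N.
Hypothesis L0 : (0 < L)%N.
Hypothesis wm0 : (0 < wm)%N.
Hypothesis u_le : forall i, (i < n)%N -> (u i <= wm)%N.
Hypothesis nM : (n <= M * M)%N.
Hypothesis nT : (n * L <= T)%N.
Hypothesis tM : (t <= M)%N.
Hypothesis mA : (2 * m + 2 <= A)%N.

Definition below (r : seq bool) := (\sum_(i < n) (item_key r L i < t) * u i)%N.

Definition deviates (b : bool) (r : seq bool) : bool :=
  if b then (t * (\sum_(i < n) u i) + M * (A * M * wm) < M * below r)%N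
  else (M * below r + M * (A * M * wm) < t * (\sum_(i < n) u i))%N.

(** The normalised [y_i] when item [i] has key [a]: [t / M] is the probability of a key below [t],
    and the sign selects the direction of the deviation. *)
Definition step_dev (b : bool) i (a : nat) : rat :=
  (-1) ^+ (~~ b) * ((u i)%:R / (M%:R * wm%:R)) * ((a < t)%N%:R - t%:R / M%:R).

Lemma M_ge2 : 2 <= M%:R :> rat.
Proof. by rewrite (ler_nat _ 2) -[leqLHS](expn1 2) leq_exp2l. Qed.

Lemma wmR_gt0 : 0 < wm%:R :> rat. Proof. by rewrite ltr0n. Qed.

Lemma step_dev_sq b i a : (i < n)%N -> step_dev b i a ^+ 2 <= 1 / (M%:R * M%:R).
Proof.
move=> hi; have hM := M_ge2; have hw := wmR_gt0.
rewrite /step_dev exprMn [X in X * _]exprMn sqrr_sign (mul1r (_ ^+ 2)).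
have h1 : ((u i)%:R / (M%:R * wm%:R)) ^+ 2 <= 1 / (M%:R * M%:R) :> rat.
  have : (u i)%:R / (M%:R * wm%:R) <= 1 / M%:R :> rat.
    rewrite ler_pdivrMr ?mulr_gt0 //; last lra.
    rewrite mulrA divfK; last by apply/eqP; lra.
    by rewrite mul1r ler_nat u_le.
  have : 0 <= (u i)%:R / (M%:R * wm%:R) :> rat.
    by apply: divr_ge0 => //; apply: mulr_ge0; lra.
  move=> h0 h1; have -> : 1 / (M%:R * M%:R) = (1 / M%:R) ^+ 2 :> rat by field; apply/eqP; lra.
  by apply: lerXn2r => //; rewrite nnegrE //; exact: le_trans h1.
have h2 : ((a < t)%N%:R - t%:R / M%:R) ^+ 2 <= 1 :> rat.
  have : 0 <= t%:R / M%:R :> rat by apply: divr_ge0 => //; lra.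
  have : t%:R / M%:R <= 1 :> rat by rewrite ler_pdivrMr ?mul1r ?ler_nat //; lra.
  move: (t%:R / M%:R) => q q1 q0; rewrite expr2.
  have : 0 <= q * (1 - q) by apply: mulr_ge0; lra.
  case: (a < t)%N => /= h; lra.
rewrite -[leRHS]mulr1; apply: ler_pM => //; exact: sqr_ge0.
Qed.

Lemma sum_step_dev b i : \sum_(a < M) (1 + step_dev b i a) = M%:R.
Proof.
have hM := M_ge2.
rewrite big_split /= sumr_const card_ord -mulr_sumr big_split /= sumr_const card_ord.
suff -> : \sum_(a < M) (a < t)%N%:R = t%:R :> rat.
  rewrite mulNrn -(mulr_natr (t%:R / M%:R)) divfK; last by apply/eqP; lra.
  by rewrite subrr mulr0 addr0.
rewrite -natr_sum; congr (_%:R); rewrite -(big_mkord xpredT (fun a => nat_of_bool (a < t)%N)).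
rewrite (big_cat_nat (n := t)) //=.
have -> : (\sum_(0 <= a < t) (a < t) = t)%N.
  rewrite (eq_big_nat _ _ (F2 := fun=> 1%N)) ?sum_nat_const_nat ?subn0 ?muln1 //.
  by move=> a /andP[_ ->].
rewrite big_nat_cond big1 ?addn0 // => a.
by move=> /andP[/andP[h _] _]; rewrite ltnNge h.
Qed.

Lemma deviation_bound b :
  (#|[set r : T.-tuple bool | deviates b r]| * 2 ^ m <= 2 ^ T)%N.
Proof.
have hM := M_ge2; have hw := wmR_gt0.
have hMM : 0 < M%:R * M%:R :> rat by apply: mulr_gt0; lra.
pose phi (r : seq bool) := \prod_(i < n) (1 + step_dev b i (item_key r L i)).
have dev_ge i a : (i < n)%N -> - (1 / 2) <= step_dev b i a.
  move=> hi; have := step_dev_sq b a hi.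
  have : 1 / (M%:R * M%:R) <= 1 / 4 :> rat.
    rewrite ler_pdivrMr //.
    have : 0 <= (M%:R - 2) * (M%:R + 2) :> rat by apply: mulr_ge0; lra.
    lra.
  rewrite expr2; move: (step_dev _ _ _) => x h1 h2; rewrite leNgt; apply/negP => hx.
  have : 0 < (- x - 1 / 2) * (- x + 1 / 2) by apply: mulr_gt0; lra.
  lra.
have phi0 r : 0 <= phi r.
  by apply: prodr_ge0 => i _; have := dev_ge i (item_key r L i) (ltn_ord i); lra.
have Ephi : \sum_(r : T.-tuple bool) phi r = 2 ^+ T.
  rewrite (sum_prod_keys (fun i a => 1 + step_dev b i a) nT).
  under eq_bigr => i _ do rewrite sum_step_dev.
  by rewrite prodr_const card_ord natrX -exprM -exprD (mulnC L) subnK.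
have big r : deviates b r -> 2 ^+ m <= phi r.
  (* Dividing by [M * wm] turns a deviation of [A * M * wm] into [\sum y_i >= A], and the squares
     sum to at most [n / M^2 <= 1]. *)
  move=> hr; apply: (@prod_lower _ n (A - 2)) => //; first lia.
  - by move=> i; apply: dev_ge.
  - apply: (@le_trans _ _ (\sum_(i < n) 1 / (M%:R * M%:R))).
      by apply: ler_sum => i _; apply: step_dev_sq.
    rewrite sumr_const card_ord -(mulr_natr (1 / _)) mulrAC mul1r ler_pdivrMr //.
    by rewrite mul1r -natrM ler_nat.
  - have -> : (A - 2)%:R + 2 = A%:R :> rat by rewrite -natrD subnK //; lia.
    have -> : \sum_(i < n) step_dev b i (item_key r L i) =
       (-1) ^+ (~~ b) * (M%:R * (below r)%:R - t%:R * (\sum_(i < n) u i)%:R) / (M%:R * (M%:R * wm%:R)).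
      rewrite /step_dev /below !natr_sum.
      rewrite mulr_sumr mulr_sumr -sumrB mulr_sumr mulr_suml.
      apply: eq_bigr => i _; rewrite natrM; field.
      by apply/andP; split; apply/eqP; lra.
    rewrite ler_pdivlMr ?mulr_gt0 //; try lra.
    have -> : A%:R * (M%:R * (M%:R * wm%:R)) = (M * (A * M * wm))%N%:R :> rat by rewrite !natrM; ring.
    move: hr; rewrite /deviates; case: b {dev_ge phi phi0 Ephi} => /=.
      by rewrite expr0 mul1r -!natrM lerBrDl -natrD ler_nat; exact: ltnW.
    by rewrite expr1 mulN1r opprB -!natrM lerBrDl -natrD ler_nat; exact: ltnW.
(* Markov's inequality by counting: the nonnegative terms of the other strings are dropped. *)
rewrite -(ler_nat rat) natrM !natrX -Ephi mulr_natl -sumr_const.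
rewrite [leRHS](bigID (mem [set r : T.-tuple bool | deviates b r])) /=.
apply: ler_wpDr; first exact: sumr_ge0.
by apply: ler_sum => r; rewrite inE; exact: big.
Qed.

End Deviation.

(** A union bound over [M + 1] thresholds and two directions. It needs [n ^ d * 2 (M + 1) <= 2 ^ m];
    since [n <= 2 ^ (2 L)] and [2 (M + 1) <= 2 ^ (L + 2)], the choice [m = (2 d + 2) (L + 1)] works,
    and [2 m + 2 <= C (L + 1)] explains [C = 4 d + 6]. *)
Lemma unbalanced_card d n T (wv : nat -> nat) (S : {set 'I_n}) :
  1 < n -> (forall i, i < n -> 0 < wv i) -> n * up_log 4 n <= T ->
  n ^ d * #|[set r : T.-tuple bool | ~~ balanced (4 * d + 6) wv S (item_key r (up_log 4 n))]| <= 2 ^ T.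
Proof.
move=> n1 w0 nT; set L := up_log 4 n in nT *; set M := 2 ^ L.
set wm := \max_(i < n) wv i; set C := 4 * d + 6.
have n0 : 0 < n by lia.
have wm0 : 0 < wm.
  by apply: leq_trans (w0 0 n0) _; rewrite /wm (bigD1 (Ordinal n0)) //= leq_maxl.
have L0 : 0 < L by apply: L_gt0.
have nM : n <= M * M by apply: M_ge.
(* Items outside [S] get weight 0, so that the deviation bound, a sum over all items, measures [S]
   alone. *)
pose u i := if insub i is Some x then (x \in S) * wv i else 0.
have uE (x : 'I_n) : u x = (x \in S) * wv x by rewrite /u valK.
have u_le i : i < n -> u i <= wm.
  move=> hi; rewrite -[i]/(nat_of_ord (Ordinal hi)) uE.
  have h : wv i <= wm by rewrite /wm (bigD1 (Ordinal hi)) //= leq_maxl.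
  by case: (_ \in S); rewrite ?mul1n ?mul0n.
pose m := (2 * d + 2) * (L + 1).
have mA : 2 * m + 2 <= C * (L + 1) by rewrite /C /m; nia.
pose dev (p : 'I_M.+1 * bool) (r : T.-tuple bool) := deviates n L (C * (L + 1)) wm p.1 u p.2 r.
have hdev p : #|[set r | dev p r]| * 2 ^ m <= 2 ^ T.
  by apply: deviation_bound => //; case: p => -[t ht] b /=.
have hws : \sum_(x in S) wv x = \sum_(i < n) u i.
  rewrite big_mkcond; apply: eq_bigr => x _; rewrite uE; by case: (x \in S); rewrite ?mul1n.
have hpw r t : prefix_weight wv (item_key r L) S t = below n L t u r.
  rewrite /prefix_weight /below big_mkcond; apply: eq_bigr => x _; rewrite uE.
  by case: (x \in S); case: (_ < t); rewrite ?mul1n.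
have hbad (r : T.-tuple bool) : ~~ balanced C wv S (item_key r L) -> exists p, dev p r.
  rewrite negb_forall => /existsP[t]; rewrite negb_and -!ltnNge hpw hws => /orP[h|h].
    by exists (t, true).
  by exists (t, false).
set bad := [set r : T.-tuple bool | _].
have hcard : #|bad| <= \sum_(p : 'I_M.+1 * bool) #|[set r | dev p r]|.
  rewrite -sum1_card big_mkcond /=.
  under [leqRHS]eq_bigr => p _ do rewrite -sum1_card big_mkcond.
  rewrite exchange_big; apply: leq_sum => r _; rewrite inE; case: ifP => // /hbad[p hp].
  by rewrite (bigD1 p) //= inE hp.
have h2 : #|bad| * 2 ^ m <= M.+1 * 2 * 2 ^ T.
  apply: leq_trans (leq_mul hcard (leqnn _)) _; rewrite big_distrl /=.
  apply: leq_trans (leq_sum _ (fun p _ => hdev p)) _.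
  by rewrite sum_nat_const card_prod card_ord card_bool.
have h3 : n ^ d * (M.+1 * 2) <= 2 ^ m.
  have h : n ^ d <= 2 ^ (2 * L * d).
    rewrite expnM mul2n -addnn expnD -/M.
    by case: (posnP d) => [->|d0]; rewrite ?expn0 ?leq_exp2r.
  have h' : M.+1 * 2 <= 2 ^ (L + 2).
    rewrite addn2 !expnS -/M; have : 0 < M by rewrite expn_gt0.
    lia.
  apply: leq_trans (leq_mul h h') _; rewrite -expnD leq_exp2l // /m; nia.
rewrite -(leq_pmul2r (_ : 0 < 2 ^ m)) ?expn_gt0 // -mulnA.
apply: leq_trans (leq_mul (leqnn _) h2) _.
by rewrite mulnA mulnC leq_mul2l h3 orbT.
Qed.

(** If an optimal set left a gap of at least the largest weight, any missing item could be added,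
    with a strictly larger profit; if no item is missing, the set has the full weight. *)
Lemma heavy_optimum n W (wv pv : nat -> nat) :
  0 < n -> (forall i, i < n -> 0 < wv i) -> (forall i, i < n -> 0 < pv i) ->
  let W' := minn W (\sum_(i < n) wv i) in
  exists S : {set 'I_n}, [/\ \sum_(x in S) wv x <= W',
    W' < \sum_(x in S) wv x + (\max_(i < n) wv i) &
    \sum_(x in S) pv x = \max_(T : {set 'I_n} | \sum_(x in T) wv x <= W) \sum_(x in T) pv x].
Proof.
move=> n0 w0 p0 W'.
have ne : 0 < #|[pred T : {set 'I_n} | \sum_(x in T) wv x <= W]|.
  by apply/card_gt0P; exists set0; rewrite inE big_set0.
have [S hS eS] := eq_bigmax_cond (fun T : {set 'I_n} => \sum_(x in T) pv x) ne.
rewrite inE in hS; exists S; split=> //.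
- by rewrite leq_min hS /=; rewrite [leqRHS](bigID (mem S)) /= leq_addr.
- rewrite ltnNge; apply/negP => hW.
  have [x xS] : exists x, x \notin S.
    apply/existsP; rewrite -[X in is_true X]negbK negb_exists; apply/negP => /forallP h.
    have : \sum_(x in S) wv x = \sum_(x < n) wv x.
      by apply: eq_bigl => x; have := h x; rewrite negbK.
    move=> e; rewrite e in hW; have := leq_trans hW (geq_minr _ _).
    rewrite -[leqRHS]addn0 leq_add2l leqNgt (leq_trans (w0 0 n0)) //.
    by rewrite (bigD1 (Ordinal n0)) //= leq_maxl.
  have hx : \sum_(y in x |: S) wv y <= W.
    rewrite big_setU1 //= addnC; apply: leq_trans (leq_trans hW (geq_minl _ _)).
    by rewrite leq_add2l (bigD1 x) //= leq_maxl.
  have : \sum_(y in x |: S) pv y <= \max_(T : {set 'I_n} | \sum_(x in T) wv x <= W) \sum_(x in T) pv x.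
    by rewrite (bigD1 (x |: S)) //= leq_maxl.
  rewrite (_ : \max_(T : {set 'I_n} | _) _ = \sum_(x in S) pv x); last exact: eS.
  by rewrite big_setU1 //= -[leqRHS]add0n leq_add2r leqNgt p0.
Qed.

(** The sweeps cost [480 * n * D], and [n * D <= 4 * C * X] with [X = n * s * wm * l], whence 1920;
    1000 covers the rest. The final [+ 1] is the halting step. The second bound says that [T] random
    bits are enough for all the keys. *)
Lemma cost_le n wm C :
  1 < n -> 0 < wm ->
  let L := up_log 4 n in let M := 2 ^ L in let D := C * (L + 1) * M * wm in
  200 + n * 12 + (20 + 40 * n + (20 + 40 * n + (20 + n * (60 + 40 * L) + (30 +
       (20 + M * (60 + 110 * n) + n * (8 * D * 60) + (20 + wm * 30)))))) + 1
  <= time_bound (1000 + 1920 * C) 1 n wm /\ n * L <= time_bound (1000 + 1920 * C) 1 n wm.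
Proof.
move=> n1 wm0 L M D; rewrite /time_bound expn1.
have hs : n < (Nat.sqrt n).+1 * (Nat.sqrt n).+1.
  by have := Nat.sqrt_spec n; lia.
move: (Nat.sqrt n).+1 hs => s hs.
have hM2 : M * M < 4 * n := M_lt n1.
have hMn : M < 2 * n := M_le n1.
have hMs : M <= 2 * s by rewrite leqNgt; apply/negP => h; have := leq_mul (ltnW h) (ltnW h); nia.
have hL : L <= (trunc_log 2 (n + wm)).+1.
  rewrite -trunc_logMp //; last lia.
  by apply: trunc_log_max => //; rewrite -/M; lia.
move: (trunc_log 2 (n + wm)).+1 (ltn0Sn (trunc_log 2 (n + wm))) hL => l l0 hL.
have s0 : 0 < s by nia.
have n0 : 0 < n by lia.
pose X := n * s * wm * l.
have eX : (1000 + 1920 * C) * n * s * wm * l = (1000 + 1920 * C) * X by rewrite /X -!mulnA.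
have hnX : n <= X by rewrite /X -!mulnA; apply: leq_pmulr; rewrite !muln_gt0 s0 wm0.
have hwX : wm <= X by rewrite /X -mulnA mulnCA; apply: leq_pmulr; rewrite !muln_gt0 s0 n0.
have hnLX : n * L <= X.
  rewrite /X mulnC [leqRHS]mulnC; apply: leq_mul => //.
  by rewrite -mulnA; apply: leq_pmulr; rewrite muln_gt0 s0.
have hsnX : n * s <= X by rewrite /X -mulnA; apply: leq_pmulr; rewrite muln_gt0 wm0.
have hMnX : M * n <= 2 * X.
  by apply: (@leq_trans (2 * (n * s))); [rewrite mulnC mulnCA leq_mul2l hMs orbT | rewrite leq_mul2l hsnX orbT].
have hMX : M <= 2 * X by apply: leq_trans hMnX; apply: leq_pmulr.
have hDX : n * D <= 4 * (C * X).
  have h1 : (L + 1) * M <= 2 * l * (2 * s) by apply: leq_mul => //; lia.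
  have -> : n * D = C * n * wm * ((L + 1) * M) by rewrite /D; ring.
  have -> : 4 * (C * X) = C * n * wm * (2 * l * (2 * s)) by rewrite /X; ring.
  by rewrite leq_mul2l h1 orbT.
rewrite eX; split; last by apply: leq_trans hnLX _; apply: leq_pmull.
have hX0 : 0 < X by apply: leq_trans n0 hnX.
clearbody X D M L; move: hnX hwX hnLX hMnX hMX hDX hX0; clear => *; lia.
Qed.

(** * The initial memory and the complete run *)

Lemma init_mem_w n W (w p : 'I_n -> nat) (i : 'I_n) : init_mem W w p (2 + 2 * i) = w i.
Proof.
rewrite /init_mem !addSn add0n /= (_ : (2 * i).+2 - 2 = 2 * i); last lia.
by rewrite mul2n doubleK valK /= odd_double.
Qed.

Lemma init_mem_p n W (w p : 'I_n -> nat) (i : 'I_n) : init_mem W w p (3 + 2 * i) = p i.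
Proof.
have e : (3 + 2 * i - 2)./2 = i by lia.
by rewrite /init_mem e valK oddD oddM; do 2![case: eqP => [?|_]; first lia].
Qed.

Lemma init_mem_out n W (w p : 'I_n -> nat) z : n + n + 2 <= z -> init_mem W w p z = 0.
Proof.
move=> hz; rewrite /init_mem; case: eqP => [?|_]; first lia.
case: eqP => [?|_]; first lia.
by rewrite insubF //; lia.
Qed.

Lemma init_mem_le n W (w p : 'I_n -> nat) z :
  init_mem W w p z <= 2 + n + W + \sum_(i < n) (w i + p i).
Proof.
rewrite /init_mem; case: eqP => [_|_]; first lia.
case: eqP => [_|_]; first lia.
case: insubP => // i _ _; rewrite (bigD1 i) //=.
by case: ifP => _; lia.
Qed.

Lemma exec_halt P r B f q m u :
  nth IHalt P q = IHalt -> exec P r B f.+1 (State q m u) = Some (m 0).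
Proof. by move=> /= ->. Qed.

Section Execution.
Variables (d n W : nat) (w p : 'I_n -> nat).
Hypothesis n1 : 1 < n.
Hypothesis w0 : forall i, 0 < w i.
Hypothesis p0 : forall i, 0 < p i.

Let C := 4 * d + 6.
Let K := C + 8.
Let cw := K * 20.
Let U := 2 + n + W + \sum_(i < n) (w i + p i).
Let wv i := init_mem W w p (2 + 2 * i).
Let pv i := init_mem W w p (3 + 2 * i).
Definition solver c := prologue ++ comp (prog c) 103.

Lemma solver_correct (S : {set 'I_n}) T (r : seq bool) :
  time_bound (1000 + 1920 * C) 1 n (wmax w) <= T ->
  \sum_(x in S) wv x <= minn W (\sum_(i < n) wv i) ->
  minn W (\sum_(i < n) wv i) < \sum_(x in S) wv x + \max_(i < n) wv i ->
  \sum_(x in S) pv x = \max_(Q : {set 'I_n} | \sum_(x in Q) wv x <= W) \sum_(x in Q) pv x ->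
  balanced C wv S (item_key r (up_log 4 n)) ->
  exec (solver C) r (word_bound cw W w p) T (init_state W w p) = Some (\sum_(x in S) pv x).
Proof.
move=> hT hS1 hS2 hS3 hb.
have hw (i : 'I_n) : wv i = w i by apply: init_mem_w.
have hp (i : 'I_n) : pv i = p i by apply: init_mem_p.
have sum2 : n + n <= \sum_(i < n) (w i + p i).
  have -> : n + n = \sum_(i < n) 2 by rewrite sum_nat_const card_ord; lia.
  by apply: leq_sum => i _; have := w0 i; have := p0 i; lia.
have swU : \sum_(i < n) wv i <= U.
  apply: (@leq_trans (\sum_(i < n) (w i + p i))); last by rewrite /U leq_addl.
  by apply: leq_sum => i _; rewrite hw leq_addr.
have spU : \sum_(i < n) pv i <= U.
  apply: (@leq_trans (\sum_(i < n) (w i + p i))); last by rewrite /U leq_addl.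
  by apply: leq_sum => i _; rewrite hp leq_addl.
have nU : n + n + 2 <= U by rewrite /U; lia.
have WU : W <= U by rewrite /U; lia.
have U8 : 8 <= U by rewrite /U; lia.
have wv0 i : i < n -> 0 < wv i by move=> hi; rewrite -[i]/(nat_of_ord (Ordinal hi)) hw.
have ewm : \max_(i < n) wv i = wmax w by apply: eq_bigr => i _; rewrite hw.
have wm0 : 0 < wmax w.
  by rewrite -ewm (bigD1 (Ordinal (ltnW n1))) //= leq_max wv0 // ltnW.
have cw7 : 6 < cw by rewrite /cw /K; lia.
have K7 : 6 < K by rewrite /K; lia.
have [m [k0 [hk0 s1 [m1 m2] [hsim hbd]]]] :=
  @prologue_ok (comp (prog C) 103) r U cw n W (init_mem W w p) n1 nU WU
    (init_mem_le W w p) erefl erefl (@init_mem_out n W w p) cw7 K (ltnW K7).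
set s := Store _ _ _ in hsim hbd.
(* Here [K = C + 3 + 5]: [U ^ C] absorbs [C], and [U ^ 5 >= 9] absorbs both the factor 8 and the
   summand [U]. *)
have VU : U + 8 * C * (U * U * U) <= U ^ K.
  have -> : U ^ K = U ^ C * (U * U * U) * (U ^ 5).
    by rewrite /K (_ : C + 8 = C + 3 + 5) ?expnD //; [rewrite !expnS expn0 ; lia|lia].
  have h1 : C <= U ^ C by apply: ltnW; apply: ltn_expl; lia.
  have h2 : 9 <= U ^ 5 by apply: (@leq_trans (8 ^ 5)) => //; rewrite leq_exp2r.
  have h3 : U <= U * U * U by rewrite -mulnA; apply: leq_pmulr; rewrite muln_gt0; lia.
  have h4 : C * (U * U * U) <= U ^ C * (U * U * U) by rewrite leq_mul2r h1 orbT.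
  have h5 : U * U * U <= C * (U * U * U) by apply: leq_pmull; rewrite /C; lia.
  apply: leq_trans (leq_mul h4 h2); rewrite -(mulnA 8).
  by move: h5 h3; move: (C * (U * U * U)) (U * U * U); clear; lia.
have hin : input_ok n wv pv s by move=> i hi; split.
have hC1 : 0 < C by rewrite /C; lia.
have [o q hk] := prog_ok n1 hC1 nU WU VU swU spU wv0 hS1 hS2 hS3 hb
  (m1 : rg s 1 = n) (m2 : rg s 2 = W) (erefl : us s = 0) hin (fun v => erefl).
have X4 : (n + n) ^ 4 <= U ^ 4 by rewrite leq_exp2r; lia.
have Xc : ncell <= (n + n) ^ 4.
  by apply: (@leq_trans (4 ^ 4)) => //; rewrite leq_exp2r; lia.
have hcode : code_at (solver C) 103 (comp (prog C) 103).
  by move=> i hi; rewrite nth_cat /= addKn.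
have [m' [s2 hsim' _]] := comp_ok (ltnW (ltnW (ltnW (ltnW (ltnW (ltnW U8)))))) K7 (leqnn (K * 20)) X4 Xc isT hsim hbd
  (prog_wf (leq_addl C 8) (leq_addr 8 C)) o hcode.
have [h1 _ _ _ _] := hsim'.
have [hT1 _] := cost_le C n1 wm0.
rewrite ewm in hk.
(* At least one unit of fuel remains for the halt, which happens when the program counter runs past
   the code. *)
have eT : T = k0 + cost r (prog C) s + (T - (k0 + cost r (prog C) s) - 1).+1.
  move: hT hT1 hk hk0; move: (time_bound _ _ _ _) (cost _ _ _); clear; lia.
rewrite eT /word_bound -/U.
have := steps_trans s1 s2; rewrite /steps => ->.
rewrite exec_halt ?h1 ?q //.
Qed.
End Execution.

(* For every exponent d (the "high probability" 1 - 1/n^d), there is a fixed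
   randomized word-RAM program and constants c, k, cw such that on every
   knapsack instance, with probability >= 1 - 1/n^d over the random bits, the
   program halts within c * n^{3/2} * wmax * polylog steps (word size
   O(log input magnitude)) and outputs OPT. *)
Theorem theorem1 :
  forall d : nat,
  exists (P : seq instr) (c k cw : nat),
  forall (n W : nat) (w p : 'I_n -> nat),
    0 < W -> (forall i, 0 < w i) -> (forall i, 0 < p i) ->
    let T := time_bound c k n (wmax w) in
    (n ^ d - 1) * 2 ^ T <=
      n ^ d * #|[set r : T.-tuple bool |
                  exec P r (word_bound cw W w p) T (init_state W w p)
                  == Some (OPT W w p)]|.
Proof.
move=> d; set C := 4 * d + 6.
exists (solver C), (1000 + 1920 * C), 1, ((C + 8) * 20) => n W w p W0 w0 p0.
set T := time_bound _ _ _ _; cbv zeta.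
(* For [n <= 1] the truncated difference [n ^ d - 1] is 0 and nothing is claimed. *)
have [n1|n1] := leqP n 1.
  have -> : n ^ d - 1 = 0; last by rewrite mul0n.
  apply/eqP; rewrite subn_eq0; move: n1; case: (n) => [|[|k]] // _; last by rewrite exp1n.
  by case: (d) => [|d']; rewrite ?expn0 ?exp0n.
pose wv i := init_mem W w p (2 + 2 * i); pose pv i := init_mem W w p (3 + 2 * i).
have hw (i : 'I_n) : wv i = w i by apply: init_mem_w.
have hp (i : 'I_n) : pv i = p i by apply: init_mem_p.
have wv0 i : i < n -> 0 < wv i by move=> hi; rewrite -[i]/(nat_of_ord (Ordinal hi)) hw.
have pv0 i : i < n -> 0 < pv i by move=> hi; rewrite -[i]/(nat_of_ord (Ordinal hi)) hp.
have [S [hS1 hS2 hS3]] := heavy_optimum W (ltnW n1) wv0 pv0.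
have eOPT : OPT W w p = \sum_(x in S) pv x.
  rewrite hS3 /OPT; apply: eq_big => [Q|Q _]; last by apply: eq_bigr => x _; rewrite hp.
  by congr (_ <= _); apply: eq_bigr => x _; rewrite hw.
have ewm : \max_(i < n) wv i = wmax w by apply: eq_bigr => i _; rewrite hw.
have wm0 : 0 < wmax w.
  by rewrite -ewm (bigD1 (Ordinal (ltnW n1))) //= leq_max wv0 // ltnW.
have [_ hT] := cost_le C n1 wm0.
have hbad := @unbalanced_card d n T wv S n1 wv0 hT.
rewrite eOPT mulnBl mul1n leq_subLR.
set good := [set r : T.-tuple bool | _].
set bad := [set r : T.-tuple bool | _] in hbad.
(* A string with balanced keys yields the optimum with certainty, so only unbalanced strings can
   fail. *)
have hcover : 2 ^ T <= #|bad| + #|good|.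
  have -> : 2 ^ T = #|{: T.-tuple bool}| by rewrite card_tuple card_bool.
  rewrite -cardsT -(cardsID bad setT) setTI; apply: leq_add => //.
  apply: subset_leq_card; apply/subsetP => r; rewrite !inE negbK andbT => hr.
  by apply/eqP; apply: solver_correct.
by apply: leq_trans (leq_mul (leqnn (n ^ d)) hcover) _; rewrite mulnDr leq_add2r.
Qed.
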